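(* Let $E_1,E_2$ be disjoint finite sets and let $\mathscr{C}$ be a matroid on $E_1\sqcup E_2$. (1) Let $\mathbb{K}$ be any field. If $\mathscr{C}$ is algebraic over $\mathbb{K}$, then for every matroid $M$ on $E_1$ that is algebraic over $\mathbb{K}$, the matroid $\mathscr{C}_*(M)$ on $E_2$ is algebraic over $\mathbb{K}$. (2) Let $\mathbb{K}$ be any infinite field. If $\mathscr{C}$ is representable over $\mathbb{K}$, then for every matroid $M$ on $E_1$ that is representable over $\mathbb{K}$, the matroid $\mathscr{C}_*(M)$ on $E_2$ is representable over $\mathbb{K}$.
   Context: All matroids are on finite ground sets. For matroids $M,N$ on the same ground set $E$, the union $M\vee N$ is the matroid whose independent sets are the sets $I\cup J$ with $I$ independent in $M$ and $J$ independent in $N$. The intersection $M\wedge N$ is the matroid on $E$ dual to the union of the duals of $M$ and $N$; equivalently, its bases are the inclusion-minimal sets among $\{B\cap B' : B \text{ a basis of } M,\ B'\text{ a basis of } N\}$. $\mathbf{B}_{E}$ denotes the Boolean matroid on $E$ (its only basis is $E$), $\oplus$ denotes direct sum and $\setminus$ denotes deletion. For a matroid $\mathscr{C}$ on $E_1\sqcup E_2$, the matroid correspondence $\mathscr{C}_*$ sends a matroid $M$ on $E_1$ to the matroid $\mathscr{C}_*(M):=\big((M\oplus \mathbf{B}_{E_2})\wedge \mathscr{C}\big)\setminus E_1$ on $E_2$. A matroid on $E$ is algebraic over $\mathbb{K}$ if there are a field extension $L/\mathbb{K}$ and elements $(a_e)_{e\in E}$ of $L$ such that $\mathrm{rk}(S)=\operatorname{tr.deg}_{\mathbb{K}}\mathbb{K}(a_e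 : e\in S)$ for all $S\subseteq E$. *)

(* Defs.v *)
From HB Require Import structures.
From mathcomp Require Import all_boot all_order all_algebra.
From mathcomp Require Import mpoly.

Set Implicit Arguments.
Unset Strict Implicit.
Unset Printing Implicit Defensive.

Import GRing.Theory.

(* A matroid whose ground set is the whole of the finite type [E]. *)
Record matroid (E : finType) := Matroid {
  indep : {set E} -> bool;
  indep0 : indep set0;
  indepS : forall I J : {set E}, I \subset J -> indep J -> indep I;
  indep_aug : forall I J : {set E}, indep I -> indep J -> #|I| < #|J| ->
    exists2 e, e \in J :\: I & indep (e |: I)
}.

Definition base (E : finType) (M : matroid E) (B : {set E}) : bool :=
  maxset (indep M) B.

Definition rk (E : finType) (M : matroid E) (S : {set E}) : nat :=
  \max_(I : {set E} | indep M I && (I \subset S)) #|I|.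

Section Operations.

Variable E : finType.
Implicit Types (M N : matroid E) (I J X Y S B : {set E}).

Lemma base_indep M B : base M B -> indep M B.
Proof. exact: maxsetp. Qed.

Lemma indep_extend M I S :
  indep M I -> I \subset S ->
  exists J, [/\ I \subset J, J \subset S, indep M J &
    forall X, indep M X -> X \subset S -> #|X| <= #|J|].
Proof.
move=> iI IS.
pose P (J : {set E}) := [&& I \subset J, J \subset S & indep M J].
have PI : P I by rewrite /P subxx IS iI.
case: (@arg_maxnP _ I P (fun J : {set E} => #|J|) PI) => J /and3P [IJ JS iJ] max_J.
exists J; split=> // X iX XS; rewrite leqNgt; apply/negP => lt_JX.
have [e /setDP [eX eJ] iJe] := indep_aug iJ iX lt_JX.
have /max_J : P (e |: J).
  by rewrite /P iJe (subset_trans IJ (subsetU1 _ _)) subUset sub1set JS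
             (subsetP XS _ eX).
by rewrite cardsU1 eJ add1n; lazy beta; rewrite /= ltnn.
Qed.

Lemma indep_leq_base M I B : base M B -> indep M I -> #|I| <= #|B|.
Proof.
move=> /maxsetP [iB max_B] iI; rewrite leqNgt; apply/negP => lt_BI.
have [e /setDP [_ /negP eB] iBe] := indep_aug iB iI lt_BI.
by apply: eB; rewrite -(max_B _ iBe (subsetU1 _ _)) setU11.
Qed.

Lemma indep_card_base M I B :
  base M B -> indep M I -> #|B| <= #|I| -> base M I.
Proof.
move=> bB iI le_BI; apply/maxsetP; split=> // J iJ IJ.
by apply/eqP; rewrite eq_sym eqEcard IJ (leq_trans (indep_leq_base bB iJ)).
Qed.

Lemma base_exists M : exists B, base M B.
Proof. by have [B bB _] := maxset_exists (indep0 M); exists B. Qed.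

Definition boolean_matroid : matroid E.
Proof.
apply: (@Matroid E (fun=> true)) => // I J _ _ lt_IJ.
have /subsetPn [e eJ eI] : ~~ (J \subset I).
  by apply: contraL lt_IJ => /subset_leq_card; rewrite -leqNgt.
by exists e; rewrite // inE eI.
Defined.

Definition dual_indep M X : bool := [exists B, base M B && [disjoint X & B]].

Lemma dual_indepP M X :
  reflect (exists2 B, base M B & [disjoint X & B]) (dual_indep M X).
Proof.
apply: (iffP existsP) => [[B /andP []]|[B bB dB]]; first by exists B.
by exists B; rewrite bB.
Qed.

Lemma dual_indep0 M : dual_indep M set0.
Proof.
have [B bB] := base_exists M.
by apply/dual_indepP; exists B; rewrite // -setI_eq0 set0I.
Qed.

Lemma dual_indepS M I J : I \subset J -> dual_indep M J -> dual_indep M I.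
Proof.
move=> IJ /dual_indepP [B bB dB]; apply/dual_indepP; exists B => //.
exact: disjointWl IJ dB.
Qed.

Lemma dual_indep_aug M X Y : dual_indep M X -> dual_indep M Y -> #|X| < #|Y| ->
  exists2 e, e \in Y :\: X & dual_indep M (e |: X).
Proof.
move=> /dual_indepP [A bA dXA] /dual_indepP [B bB dYB] lt_XY.
have iBX : indep M (B :\: X) by apply: indepS (subsetDl _ _) (base_indep bB).
have sBX : B :\: X \subset ~: X by rewrite setDE subsetIr.
have [D [BD DX iD max_D]] := indep_extend iBX sBX.
have bD : base M D.
  apply: indep_card_base bA iD (max_D _ (base_indep bA) _).
  by rewrite -disjoints_subset disjoint_sym.
have [YD|/subsetPn [e eYX eD]] := boolP (Y :\: X \subset D); last first.
  exists e => //; apply/dual_indepP; exists D => //.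
  by rewrite -setI_eq0 setIUl setU_eq0 !setI_eq0 disjoints1 eD disjoint_sym
             disjoints_subset.
have lt : #|B :&: X| < #|Y :\: X|.
  have: #|X :\: Y| < #|Y :\: X|.
    by rewrite -(ltn_add2l #|X :&: Y|) cardsID setIC cardsID.
  apply: leq_ltn_trans; apply: subset_leq_card; apply/subsetP => x.
  rewrite !inE => /andP [xB ->]; rewrite andbT; apply/negP => xY.
  by have /pred0P /(_ x) := dYB; rewrite /= xY xB.
have dis : (B :\: X) :&: (Y :\: X) = set0.
  apply/setP => x; rewrite !inE; apply/negP => /andP [/andP [_ xB] /andP [_ xY]].
  by have /pred0P /(_ x) := dYB; rewrite /= xY xB.
have: #|(B :\: X) :|: (Y :\: X)| <= #|B|.
  apply: leq_trans (indep_leq_base bB iD).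
  by apply: subset_leq_card; rewrite subUset BD YD.
rewrite cardsU dis cards0 subn0 -(cardsID X B) addnC leq_add2r.
by rewrite leqNgt lt.
Qed.

Definition dual M : matroid E :=
  Matroid (dual_indep0 M) (@dual_indepS M) (@dual_indep_aug M).

Lemma base_dual M B : base (dual M) B = base M (~: B).
Proof.
apply/idP/idP => [/maxsetP [/dual_indepP [A bA dBA] max_B]|bB].
  suff <- : ~: A = B by rewrite setCK.
  apply: max_B; last by rewrite -disjoints_subset.
  by apply/dual_indepP; exists A; rewrite // -setI_eq0 setIC setICr.
apply/maxsetP; split.
  by apply/dual_indepP; exists (~: B); rewrite // -setI_eq0 setICr.
move=> X /dual_indepP [A bA dXA] BX.
have AB : A \subset ~: B.
  by rewrite -disjoints_subset disjoint_sym (disjointWl BX dXA).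
have eAB : A = ~: B.
  by apply/eqP; rewrite eqEcard AB (indep_leq_base bA (base_indep bB)).
by apply/eqP; rewrite eqEsubset BX andbT -(setCK B) -eAB -disjoints_subset dXA.
Qed.

Definition union_indep M N X : bool :=
  [exists I, exists J, [&& indep M I, indep N J & X == I :|: J]].

Lemma union_indepP M N X :
  reflect (exists I J, [/\ indep M I, indep N J & X = I :|: J])
          (union_indep M N X).
Proof.
apply: (iffP existsP) => [[I /existsP [J /and3P [iI iJ /eqP ->]]]|].
  by exists I, J.
by case=> I [J [iI iJ ->]]; exists I; apply/existsP; exists J; rewrite iI iJ eqxx.
Qed.

Lemma union_indep0 M N : union_indep M N set0.
Proof.
by apply/union_indepP; exists set0, set0; rewrite !indep0 setU0; split.
Qed.

Lemma union_indepS M N X Y :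
  X \subset Y -> union_indep M N Y -> union_indep M N X.
Proof.
move=> XY /union_indepP [I [J [iI iJ eY]]]; apply/union_indepP.
exists (X :&: I), (X :&: J); split; try exact: indepS (subsetIr _ _) _.
by rewrite -setIUr -eY; apply/esym/setIidPl.
Qed.

Lemma union_indep_disjoint M N X : union_indep M N X ->
  exists I J, [/\ indep M I, indep N J, X = I :|: J & I :&: J = set0].
Proof.
case/union_indepP => I [J [iI iJ ->]]; exists I, (J :\: I); split=> //.
- exact: indepS (subsetDl _ _) iJ.
- by apply/setP => x; rewrite !inE; case: (x \in I).
- by apply/setP => x; rewrite !inE; case: (x \in I).
Qed.

Lemma indep_aug_disjoint M I1 J1 J2 :
  indep M I1 -> indep M J1 -> #|I1| < #|J1| -> J1 :&: J2 = set0 ->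
  exists e, [/\ e \in J1, e \notin I1, e \notin J2 & indep M (e |: I1)].
Proof.
move=> iI1 iJ1 lt dJ; have [e /setDP [eJ eI] ie] := indep_aug iI1 iJ1 lt.
exists e; split=> //; apply/negP => eJ2.
by have /setP /(_ e) := dJ; rewrite !inE eJ eJ2.
Qed.

Lemma union_indep_aug M N X Y :
  union_indep M N X -> union_indep M N Y -> #|X| < #|Y| ->
  exists2 e, e \in Y :\: X & union_indep M N (e |: X).
Proof.
move=> /union_indep_disjoint [I1 [I2 [iI1 iI2 eX dI]]].
move=> /union_indep_disjoint [J1 [J2 [iJ1 iJ2 eY dJ]]] lt_XY.
have [n] := ubnP (#|I1 :&: J2| + #|I2 :&: J1|).
elim: n I1 I2 iI1 iI2 eX dI => // n IHn I1 I2 iI1 iI2 eX dI lt_n.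
have cX : #|X| = #|I1| + #|I2| by rewrite eX cardsU dI cards0 subn0.
have cY : #|Y| = #|J1| + #|J2| by rewrite eY cardsU dJ cards0 subn0.
have [lt1|ge1] := ltnP #|I1| #|J1|.
  have [e [eJ1 eI1 eJ2 ie]] := indep_aug_disjoint iI1 iJ1 lt1 dJ.
  have [eI2|eI2] := boolP (e \in I2); last first.
    exists e; first by rewrite eX eY !inE negb_or eI1 eI2 eJ1.
    by apply/union_indepP; exists (e |: I1), I2; rewrite eX setUA; split.
  apply: (IHn (e |: I1) (I2 :\ e)) => //.
  - exact: indepS (subD1set _ _) iI2.
  - by rewrite eX; apply/setP => x; rewrite !inE; case: eqP => // ->;
       rewrite eI2 orbT.
  - apply/setP => x; rewrite !inE; case: eqP => //= _.
    by have /setP /(_ x) := dI; rewrite !inE.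
  - have -> : (e |: I1) :&: J2 = I1 :&: J2.
      by apply/setP => x; rewrite !inE; case: eqP => // ->;
         rewrite (negPf eJ2) (negPf eI1).
    have -> : (I2 :\ e) :&: J1 = (I2 :&: J1) :\ e.
      by apply/setP => x; rewrite !inE andbA.
    by move: lt_n; rewrite (cardsD1 e (I2 :&: J1)) !inE eI2 eJ1 add1n addnS.
have lt2 : #|I2| < #|J2|.
  rewrite ltnNge; apply/negP => ge2.
  by move: lt_XY; rewrite cX cY ltnNge leq_add.
have [|e [eJ2 eI2 eJ1 ie]] := indep_aug_disjoint (J2 := J1) iI2 iJ2 lt2.
  by rewrite setIC.
have [eI1|eI1] := boolP (e \in I1); last first.
  exists e; first by rewrite eX eY !inE negb_or eI1 eI2 eJ2 orbT.
  by apply/union_indepP; exists I1, (e |: I2); rewrite eX setUCA; split.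
apply: (IHn (I1 :\ e) (e |: I2)) => //.
- exact: indepS (subD1set _ _) iI1.
- by rewrite eX; apply/setP => x; rewrite !inE; case: eqP => // ->;
     rewrite eI1.
- apply/setP => x; rewrite !inE; case: eqP => //= _.
  by have /setP /(_ x) := dI; rewrite !inE.
- have -> : (e |: I2) :&: J1 = I2 :&: J1.
    by apply/setP => x; rewrite !inE; case: eqP => // ->;
       rewrite (negPf eJ1) (negPf eI2).
  have -> : (I1 :\ e) :&: J2 = (I1 :&: J2) :\ e.
    by apply/setP => x; rewrite !inE andbA.
  by move: lt_n; rewrite (cardsD1 e (I1 :&: J2)) !inE eI1 eJ2 add1n addSn.
Qed.

Definition munion M N : matroid E :=
  Matroid (union_indep0 M N) (@union_indepS M N) (@union_indep_aug M N).

Definition minter M N : matroid E := dual (munion (dual M) (dual N)).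

End Operations.

Section Correspondence.

Variables E1 E2 : finType.

Definition dsum_indep (M : matroid E1) (N : matroid E2)
    (X : {set E1 + E2}) : bool :=
  indep M (inl @^-1: X) && indep N (inr @^-1: X).

Lemma card_sum_preim (X : {set E1 + E2}) :
  #|X| = #|inl @^-1: X : {set E1}| + #|inr @^-1: X : {set E2}|.
Proof.
rewrite -(card_imset _ (@inl_inj E1 E2)) -(card_imset _ (@inr_inj E1 E2)).
set A := _ @: _; set B := _ @: _.
have dAB : A :&: B = set0.
  apply/setP => x; rewrite !inE; apply/negP => /andP [].
  by case/imsetP => y _ ->; case/imsetP.
have -> : X = A :|: B.
  apply/setP => -[x|x]; rewrite in_setU.
    rewrite (mem_imset _ _ (@inl_inj E1 E2)) inE.
    by case: imsetP => [[]|] //; rewrite orbF.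
  rewrite (mem_imset _ _ (@inr_inj E1 E2)) inE.
  by case: imsetP => [[]|].
by rewrite cardsU dAB cards0 subn0.
Qed.

Lemma dsum_indep0 M N : dsum_indep M N set0.
Proof. by rewrite /dsum_indep !preimset0 !indep0. Qed.

Lemma dsum_indepS M N (X Y : {set E1 + E2}) :
  X \subset Y -> dsum_indep M N Y -> dsum_indep M N X.
Proof.
move=> XY /andP [iM iN]; apply/andP; split.
  exact: indepS (preimsetS _ XY) iM.
exact: indepS (preimsetS _ XY) iN.
Qed.

Lemma dsum_indep_aug M N (X Y : {set E1 + E2}) :
  dsum_indep M N X -> dsum_indep M N Y -> #|X| < #|Y| ->
  exists2 e, e \in Y :\: X & dsum_indep M N (e |: X).
Proof.
move=> /andP [iXM iXN] /andP [iYM iYN]; rewrite !card_sum_preim => lt_XY.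
have [lt1|ge1] := ltnP #|inl @^-1: X : {set E1}| #|inl @^-1: Y : {set E1}|.
  have [e eYX ie] := indep_aug iXM iYM lt1.
  exists (inl e); first by rewrite !inE in eYX *.
  apply/andP; split; [apply: indepS ie | apply: indepS iXN];
    by apply/subsetP => x; rewrite !inE.
have lt2 : #|inr @^-1: X : {set E2}| < #|inr @^-1: Y : {set E2}|.
  by rewrite ltnNge; apply/negP => ge2; move: lt_XY; rewrite ltnNge leq_add.
have [e eYX ie] := indep_aug iXN iYN lt2.
exists (inr e); first by rewrite !inE in eYX *.
apply/andP; split; [apply: indepS iXM | apply: indepS ie];
  by apply/subsetP => x; rewrite !inE.
Qed.

Definition dsum (M : matroid E1) (N : matroid E2) : matroid (E1 + E2)%type :=
  Matroid (dsum_indep0 M N) (@dsum_indepS M N) (@dsum_indep_aug M N).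

(* Deletion of [E1] from a matroid on the disjoint union [E1 + E2]; the
   remaining ground set is the copy [inr @: E2], identified with [E2]. *)
Definition deletel (M : matroid (E1 + E2)%type) : matroid E2.
Proof.
apply: (@Matroid E2 (fun J => indep M (inr @: J))).
- by rewrite imset0 indep0.
- by move=> I J IJ; apply: indepS; apply: imsetS.
- move=> I J iI iJ lt_IJ.
  have [|_ /setDP [/imsetP [e eJ ->] eI] ie] := indep_aug iI iJ.
    by rewrite !card_imset //; apply: inr_inj.
  exists e; last by rewrite imsetU1.
  by rewrite inE eJ andbT; apply: contra eI; apply: imset_f.
Defined.

Definition corr (C : matroid (E1 + E2)%type) (M : matroid E1) : matroid E2 :=
  deletel (minter (dsum M (boolean_matroid E2)) C).

End Correspondence.

Local Open Scope ring_scope.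

Section Transcendence.

Variables (K L : fieldType) (iota : {rmorphism K -> L}).

(* [K(A)]: the subfield of [L] generated by the image of [K] and by [A].
   Inverses need no side condition since [0^-1 = 0]. *)
Inductive adjoin (A : L -> Prop) : L -> Prop :=
| adjoin_base c : adjoin A (iota c)
| adjoin_gen x : A x -> adjoin A x
| adjoinD x y : adjoin A x -> adjoin A y -> adjoin A (x + y)
| adjoinN x : adjoin A x -> adjoin A (- x)
| adjoinM x y : adjoin A x -> adjoin A y -> adjoin A (x * y)
| adjoinV x : adjoin A x -> adjoin A x^-1.

Definition algebraic_elt (F : L -> Prop) (x : L) : Prop :=
  exists p : {poly L}, [/\ p != 0, forall i, F p`_i & root p x].

Definition alg_indep (n : nat) (t : 'I_n -> L) : Prop :=
  forall p : {mpoly K[n]}, (map_mpoly iota p).@[t] = 0 -> p = 0.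

(* [F / K] has a transcendence basis with [n] elements. *)
Definition is_trdeg (F : L -> Prop) (n : nat) : Prop :=
  exists t : 'I_n -> L,
    [/\ forall i, F (t i),
        alg_indep t
      & forall x, F x ->
          algebraic_elt (adjoin (fun y => exists i, y = t i)) x].

End Transcendence.

Definition algebraic_matroid (K : fieldType) (E : finType)
    (M : matroid E) : Prop :=
  exists (L : fieldType) (iota : {rmorphism K -> L}) (a : E -> L),
    forall S : {set E},
      is_trdeg iota (adjoin iota (fun x => exists2 e, e \in S & x = a e))
        (rk M S).

Definition representable_matroid (K : fieldType) (E : finType)
    (M : matroid E) : Prop :=
  exists (n : nat) (v : E -> 'rV[K]_n),
    forall S : {set E}, indep M S = free [seq v e | e in S].

Definition infinite_field (K : fieldType) : Prop :=
  forall s : seq K, exists x, x \notin s.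

(* Main.v *)
Require Import Defs.
From HB Require Import structures.
From mathcomp Require Import all_boot all_order all_algebra.
From mathcomp Require Import zify polyXY fieldext mpoly boolp.
Set Implicit Arguments.
Unset Strict Implicit.
Unset Printing Implicit Defensive.

(** The definition of [corr C M] through dual matroids hides a simpler one:
    [corr C M] is the contraction by [E1] of the matroid union of [C] and [M],
    where the elements of [E2] count as loops of [M]. For bases A of [M] and B of
    [C], the sizes of the intersection of A + E2 with B and of the union of A with
    the trace of B on [E1] have a constant sum, so that minimizing the former
    amounts to maximizing the latter ([corr_indepP], [corr_represents]). It remains
    to realize direct sums, unions and contractions, by vectors or by field
    elements. Linear span and relative algebraic closure are both closure operators
    with the exchange property, and the combinatorial part is done for any such
    operator.

    Union. Let (a_e) and (b_e) realize [C] and [M] in a common space, free from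
    each other. For e in [E1] replace a_e by a mixture of a_e and b_e, namely
    a_e + k b_e with a scalar k in the linear case and a_e + b_e^n with an exponent
    n in the algebraic case. If two such mixtures lie in a flat, then so do a_e and
    b_e; hence each of the finitely many flats forbids at most one value of the
    parameter, and for any other value the mixture avoids a flat as soon as a_e or
    b_e does ([union_mix]). This is where the second part needs an infinite field,
    whereas exponents are always available.

    Contraction. For vectors it is a linear quotient. For field elements,
    contracting a transcendental element t amounts to enlarging the ground field to
    K(t), and the point is to come back to K. This is done by specializing t to an
    element c algebraic over K. A finitely generated subring of the given field is
    built by adjoining elements one at a time: first t, then a basis, then all
    elements of the family and the inverses of the leading coefficients of finitely
    many relations that witness their dependencies. At each step morphisms to other
    fields extend ([specializable_transcendental], [specializable_algebraic]),
    provided that some nonzero element of the previous ring stays nonzero; at the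
    start this is a condition D(c) <> 0, met by a root c of X D(X) + 1. The relations
    survive the specialization, and as the basis stays independent no others appear
    ([specialization], [contract_one]).

    Direct sum. The realizations of [C] and [M] live in unrelated extensions of K.
    The same specialization theorem, applied over the first extension instead of K,
    moves the second family into an extension of the first one and makes it free
    from it ([algebraic_dsum]). *)

(** * Finitary closure operators with exchange *)

(** Closure is taken of finite lists only, and is a mere predicate: it need not be
    decidable for algebraic closure in an arbitrary field. *)
Record pregeometry (T : eqType) (cl : seq T -> T -> Prop) : Prop := Pregeometry {
  cl_mem : forall s x, x \in s -> cl s x;
  cl_trans : forall s u x, (forall y, y \in s -> cl u y) -> cl s x -> cl u x;
  cl_exchange : forall s x y, cl (x :: s) y -> ~ cl s y -> cl (y :: s) x
}.

Section Pregeometry.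

Variables (T : eqType) (cl : seq T -> T -> Prop).
Hypothesis clP : pregeometry cl.

Fixpoint independent (s : seq T) : Prop :=
  if s is x :: s' then ~ cl s' x /\ independent s' else True.

Lemma cl_sub s u x : {subset s <= u} -> cl s x -> cl u x.
Proof. by move=> su; apply: cl_trans => // y /su; apply: cl_mem. Qed.

Lemma ind_swap x y s : independent (x :: y :: s) -> independent (y :: x :: s).
Proof.
case=> /= nx [ny is_]; split; last first.
  by split=> // cx; apply: nx; apply: cl_sub cx => z zs; rewrite inE zs orbT.
by move=> cy; apply: nx; apply: (cl_exchange clP).
Qed.

Lemma ind_front x s u : independent (s ++ x :: u) <-> independent (x :: s ++ u).
Proof.
elim: s => //= y s IHs; split.
  case=> ny /IHs [nx is_]; apply: ind_swap; split=> //.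
  by move=> cy; apply: ny; apply: cl_sub cy => z;
     rewrite !(mem_cat, inE) => /or3P [->|->|->]; rewrite ?orbT.
move=> /ind_swap [ny is_]; split; last exact/IHs.
by move=> cy; apply: ny; apply: cl_sub cy => z;
   rewrite !(mem_cat, inE) => /or3P [->|->|->]; rewrite ?orbT.
Qed.

Lemma ind_perm s u : perm_eq s u -> independent s -> independent u.
Proof.
elim: s u => [|x s IHs] u; first by rewrite perm_sym => /perm_nilP ->.
move=> sP [nx is_]; have xu : x \in u by rewrite -(perm_mem sP) mem_head.
case/splitPr: xu sP => u1 u2; rewrite perm_sym perm_catC /= perm_cons => sP.
apply/ind_front; split.
  move=> cx; apply: nx; apply: cl_sub cx => z.
  by rewrite -(perm_mem sP) !mem_cat orbC.
by apply: IHs => //; rewrite perm_sym perm_catC.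
Qed.

Lemma ind_catr s u : independent (s ++ u) -> independent u.
Proof. by elim: s => //= x s IHs [_]. Qed.

(** Adding the elements of [u] to [v] one at a time, there is a first one that
    puts [x] in the closure; exchange applies to that one. *)
Lemma cl_pick u v x : cl (u ++ v) x -> ~ cl v x ->
  exists u1 y u2, u = u1 ++ y :: u2 /\ cl (y :: u2 ++ v) x /\ ~ cl (u2 ++ v) x.
Proof.
elim: u => [//|y u IHu] /= cx nx.
have [cx'|nx'] := EM (cl (u ++ v) x); last by exists [::], y, u.
by have [u1 [z [u2 [-> ?]]]] := IHu cx' nx; exists (y :: u1), z, u2.
Qed.

(** The exchange step moves an element of the independent list [s] to the common
    part [v] while removing one from [u]. *)
Lemma steinitz_cat s u v :
  independent (s ++ v) -> (forall x, x \in s -> cl (u ++ v) x) -> size s <= size u.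
Proof.
elim: s u v => [//|x s IHs] u v isv su.
have nxv : ~ cl v x.
  by case: isv => nx _ cx; apply: nx; apply: cl_sub cx => z;
     rewrite mem_cat => ->; rewrite orbT.
have [u1 [y [u2 [eu [cx nx]]]]] := cl_pick (su x (mem_head _ _)) nxv.
have cy := cl_exchange clP cx nx.
rewrite eu size_cat /= addnS ltnS -size_cat.
apply: (IHs _ (x :: v)); first exact/ind_front.
move=> z zs; have : cl (u ++ v) z by apply: su; rewrite inE zs orbT.
apply: (cl_trans clP) => w; rewrite eu !(mem_cat, inE) => w_in.
have [->|nwy] := eqVneq w y.
  apply: cl_sub cy => a; rewrite !(mem_cat, inE) => /or3P [->|->|->];
  by rewrite ?orbT.
move: w_in; rewrite (negPf nwy) /= => w_in; apply: (cl_mem clP).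
by rewrite !(mem_cat, inE); case/orP: w_in => [/orP[->|->]|->]; rewrite ?orbT.
Qed.

Lemma steinitz s u : independent s -> (forall x, x \in s -> cl u x) -> size s <= size u.
Proof.
by move=> is_ su; apply: (@steinitz_cat _ _ [::]); rewrite ?cats0.
Qed.

Lemma basis_exists u :
  exists v, [/\ subseq v u, independent v & forall x, x \in u -> cl v x].
Proof.
elim: u => [|x u [v [vu iv cv]]]; first by exists [::].
have [cx|nx] := EM (cl v x).
  exists v; split=> //; first exact: subseq_trans (subseq_cons _ _).
  by move=> y; rewrite inE => /predU1P [->|/cv].
exists (x :: v); split=> //; first by rewrite /= eqxx.
move=> y; rewrite inE => /predU1P [->|/cv cy].
  by apply: (cl_mem clP); rewrite mem_head.
by apply: cl_sub cy => z zv; rewrite inE zv orbT.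
Qed.

Lemma ind_of_size s u :
  independent s -> (forall x, x \in s -> cl u x) -> size u <= size s -> independent u.
Proof.
move=> is_ su le_us; have [v [vu iv cv]] := basis_exists u.
have le_sv : size s <= size v.
  by apply: steinitz => // x /su; apply: cl_trans.
have /eqP <- // : v == u.
by rewrite -(size_subseq_leqif vu).2 eqn_leq size_subseq // (leq_trans le_us).
Qed.

End Pregeometry.

Definition contraction (T : eqType) (cl : seq T -> T -> Prop) (X : seq T) :
  seq T -> T -> Prop := fun s => cl (X ++ s).

Lemma contraction_pregeometry (T : eqType) (cl : seq T -> T -> Prop) X :
  pregeometry cl -> pregeometry (contraction cl X).
Proof.
move=> clP; rewrite /contraction; split=> [s x xs|s u x su|s x y].
- by apply: (cl_mem clP); rewrite mem_cat xs orbT.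
- apply: (cl_trans clP) => y; rewrite mem_cat => /orP [yX|/su //].
  by apply: (cl_mem clP); rewrite mem_cat yX.
move=> cy ny; apply: (@cl_sub _ _ clP (y :: X ++ s)).
  by move=> z; rewrite !(inE, mem_cat) orbCA.
apply: (cl_exchange clP) ny; apply: (@cl_sub _ _ clP) cy.
by move=> z; rewrite !(inE, mem_cat) orbCA.
Qed.

Lemma ind_contraction (T : eqType) (cl : seq T -> T -> Prop) X b s :
  pregeometry cl -> independent cl b -> {subset b <= X} ->
  (forall x, x \in X -> cl b x) ->
  independent (contraction cl X) s <-> independent cl (s ++ b).
Proof.
move=> clP ib bX bcl; elim: s => [|x s IHs] //=.
split=> -[nx /IHs is_]; split=> // cx; apply: nx; apply: (cl_trans clP) cx => y.
  rewrite mem_cat => /orP [ys|/bX yX]; apply: (cl_mem clP);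
  by rewrite mem_cat ?ys ?yX ?orbT.
rewrite mem_cat => /orP [yX|ys].
  by apply: (cl_sub clP) (bcl _ yX) => z zb; rewrite mem_cat zb orbT.
by apply: (cl_mem clP); rewrite mem_cat ys.
Qed.

Definition img (E : finType) (T : Type) (a : E -> T) (S : {set E}) : seq T :=
  [seq a e | e <- enum S].

Lemma imgP (E : finType) (T : eqType) (a : E -> T) (S : {set E}) x :
  reflect (exists2 e, e \in S & x = a e) (x \in img a S).
Proof.
by apply: (iffP mapP) => -[e eS ->]; exists e; rewrite ?mem_enum // -mem_enum.
Qed.

Lemma mem_img (E : finType) (T : eqType) (a : E -> T) (S : {set E}) e :
  e \in S -> a e \in img a S.
Proof. by move=> eS; apply/imgP; exists e. Qed.

Lemma img_sub (E : finType) (T : eqType) (a : E -> T) (S U : {set E}) :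
  S \subset U -> {subset img a S <= img a U}.
Proof. by move=> /subsetP SU _ /imgP [e /SU eU ->]; apply: mem_img. Qed.

Lemma size_img (E : finType) (T : eqType) (a : E -> T) (S : {set E}) :
  size (img a S) = #|S|.
Proof. by rewrite size_map -cardE. Qed.

Definition indset (E : finType) (T : eqType) (cl : seq T -> T -> Prop)
  (a : E -> T) (S : {set E}) : Prop := independent cl (img a S).

Definition represents (E : finType) (T : eqType) (cl : seq T -> T -> Prop)
    (a : E -> T) (M : matroid E) : Prop :=
  forall S, indep M S <-> indset cl a S.

Section Families.

Variables (E : finType) (T : eqType) (cl : seq T -> T -> Prop) (a : E -> T).
Hypothesis clP : pregeometry cl.

Lemma perm_imgU (S U : {set E}) : [disjoint S & U] ->
  perm_eq (img a (S :|: U)) (img a S ++ img a U).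
Proof.
move=> dSU; rewrite -map_cat; apply: perm_map; apply: uniq_perm.
- exact: enum_uniq.
- rewrite cat_uniq !enum_uniq andbT /= -all_predC.
  apply/allP => x; rewrite mem_enum /= mem_enum => xU.
  by rewrite (disjointFl dSU xU).
by move=> x; rewrite mem_cat !mem_enum inE.
Qed.

Lemma perm_img1U e (S : {set E}) : e \notin S ->
  perm_eq (img a (e |: S)) (a e :: img a S).
Proof.
move=> eS; have := @perm_imgU [set e] S; rewrite disjoints1 eS => /(_ isT).
by rewrite {2}/img enum_set1.
Qed.

Lemma indsetU1 e (S : {set E}) : e \notin S ->
  indset cl a (e |: S) <-> ~ cl (img a S) (a e) /\ indset cl a S.
Proof.
move=> eS; have pS := perm_img1U eS; split=> [|[nc iS]].
  exact: (ind_perm clP pS).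
by rewrite perm_sym in pS; apply: (ind_perm clP pS).
Qed.

Lemma indset_setU (S U : {set E}) : [disjoint S & U] ->
  indset cl a (S :|: U) <-> independent cl (img a S ++ img a U).
Proof.
move=> dSU; have pS := perm_imgU dSU; split; first exact: (ind_perm clP pS).
by rewrite perm_sym in pS; apply: (ind_perm clP pS).
Qed.

Lemma indsetS (S U : {set E}) : S \subset U -> indset cl a U -> indset cl a S.
Proof.
move=> SU iU; have eU : (U :\: S) :|: S = U.
  apply/setP => x; rewrite !inE.
  by have /implyP := subsetP SU x; case: (x \in S); case: (x \in U).
have dU : [disjoint U :\: S & S].
  by rewrite -setI_eq0 setIDAC setDE -setIA setICr setI0.
apply: (@ind_catr _ _ (img a (U :\: S))).
by apply/(indset_setU dU); rewrite eU.
Qed.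

Lemma indset_max (I S : {set E}) : indset cl a I -> I \subset S ->
  (forall X, indset cl a X -> X \subset S -> #|X| <= #|I|) ->
  forall e, e \in S -> cl (img a I) (a e).
Proof.
move=> iI IS max_I e eS; have [eI|eI] := boolP (e \in I).
  by apply: (cl_mem clP); apply: mem_img.
apply: contrapT => nc; have /max_I : indset cl a (e |: I) by apply/indsetU1.
by rewrite subUset sub1set eS IS cardsU1 eI add1n ltnn => /(_ isT).
Qed.

End Families.

Lemma indset_ext (E : finType) (T T' : eqType) (cl : seq T -> T -> Prop)
    (cl' : seq T' -> T' -> Prop) (a : E -> T) (a' : E -> T') :
  (forall (S : {set E}) e, cl (img a S) (a e) <-> cl' (img a' S) (a' e)) ->
  pregeometry cl -> pregeometry cl' ->
  forall S, indset cl a S <-> indset cl' a' S.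
Proof.
move=> eq_cl clP clP' S; have [n] := ubnP #|S|.
elim: n S => // n IHn S leS; have [->|[e eS]] := set_0Vmem S.
  by rewrite /indset /img enum_set0.
rewrite -(setD1K eS) !indsetU1 ?setD11 // eq_cl IHn //.
by move: leS; rewrite (cardsD1 e) eS.
Qed.

Section WeakMap.

Variables (E : finType) (T : eqType) (cl : seq T -> T -> Prop) (a : E -> T).
Hypothesis clP : pregeometry cl.

Lemma indset_extend (J S : {set E}) : indset cl a J -> J \subset S ->
  exists I : {set E}, [/\ J \subset I, I \subset S, indset cl a I &
    forall e, e \in S -> cl (img a I) (a e)].
Proof.
have [n] := ubnP (#|S| - #|J|); elim: n J => // n IHn J lt_n iJ JS.
have [all_cl|not_all] := EM (forall e, e \in S -> cl (img a J) (a e)).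
  by exists J.
have [e eS ne] : exists2 e, e \in S & ~ cl (img a J) (a e).
  apply: contrapT => no; apply: not_all => e eS; apply: contrapT => ne; apply: no.
  by exists e.
have eJ : e \notin J by apply/negP => eJ; apply: ne; apply/(cl_mem clP)/mem_img.
have eJS : e |: J \subset S by rewrite subUset sub1set eS.
have ieJ : indset cl a (e |: J) by apply/indsetU1.
have lt_eJ : #|S| - #|e |: J| < n.
  move: lt_n (subset_leq_card eJS); rewrite cardsU1 eJ add1n ltnS => lt_n lt_J.
  by apply: leq_trans lt_n; rewrite ltn_sub2l.
have [I [JI IS iI clI]] := IHn _ lt_eJ ieJ eJS.
by exists I; split=> //; apply: subset_trans JI; apply: subsetUr.
Qed.

Variables (T' : eqType) (cl' : seq T' -> T' -> Prop) (a' : E -> T').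
Hypothesis clP' : pregeometry cl'.
Hypothesis cl_imp : forall (S : {set E}) e, cl (img a S) (a e) -> cl' (img a' S) (a' e).

Lemma weak_map_indset (S : {set E}) : indset cl' a' S -> indset cl a S.
Proof.
have [n] := ubnP #|S|; elim: n S => // n IHn S leS.
have [->|[e eS]] := set_0Vmem S; first by rewrite /indset /img enum_set0.
rewrite -(setD1K eS) !indsetU1 ?setD11 // => -[ne iS]; split.
  by move=> /cl_imp.
by apply: IHn iS; move: leS; rewrite (cardsD1 e S) eS.
Qed.

(** A degeneration that does not lower the rank creates no dependency: a set
    independent before extends to a basis, which still spans the basis [B] and has
    the same size, hence is still independent. *)
Lemma weak_map_rank_eq (B : {set E}) :
  indset cl a B -> indset cl' a' B -> (forall e, cl (img a B) (a e)) ->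
  forall (S : {set E}) e, cl' (img a' S) (a' e) -> cl (img a S) (a e).
Proof.
move=> iB iB' spanB S e ce'; apply: contrapT => ne.
have ind0 : indset cl a set0 by rewrite /indset /img enum_set0.
have [I [_ IS iI clI]] := indset_extend ind0 (sub0set S).
have eI : e \notin I.
  apply/negP => eI; apply: ne; apply/(cl_mem clP)/mem_img.
  exact: (subsetP IS).
have ieI : indset cl a (e |: I).
  apply/indsetU1 => //; split=> // cI; apply: ne.
  exact: (cl_sub clP) (img_sub IS) cI.
have [D [eID _ iD spanD]] := indset_extend ieI (subsetT _).
have iD' : indset cl' a' D.
  apply: (ind_of_size clP' iB') => [_ /imgP [x _ ->]|].
    by apply: cl_imp; apply: spanD.
  rewrite !size_img -!(size_img a).
  by apply: (steinitz clP iD) => _ /imgP [x _ ->]; apply: spanB.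
have /(indsetU1 _ clP' eI) [ne' _] := indsetS clP' eID iD'.
by apply: ne'; apply: (cl_trans clP') ce' => _ /imgP [x xS ->]; apply/cl_imp/clI.
Qed.

End WeakMap.

(** * Correspondences as contractions of unions *)

Lemma card_base (E : finType) (M : matroid E) B B' :
  base M B -> base M B' -> #|B| = #|B'|.
Proof.
move=> bB bB'; apply/eqP.
by rewrite eqn_leq !(@indep_leq_base _ M) // base_indep.
Qed.

Lemma indep_sub_base (E : finType) (M : matroid E) I :
  indep M I -> exists2 B, base M B & I \subset B.
Proof. by case/maxset_exists => B bB IB; exists B. Qed.

Lemma perm_img_sum (E1 E2 : finType) (T : eqType) (a : E1 + E2 -> T) S :
  perm_eq (img a S)
    (img (a \o inr) (inr @^-1: S) ++ img (a \o inl) (inl @^-1: S)).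
Proof.
rewrite /img (map_comp a inl) (map_comp a inr) -map_cat.
apply: perm_map; apply: uniq_perm.
- exact: enum_uniq.
- rewrite cat_uniq !map_inj_uniq ?enum_uniq ?andbT; try by move=> ? ? [].
  by apply/hasPn => _ /mapP [x _ ->]; apply/negP => /mapP [].
move=> [x|x]; rewrite mem_cat mem_enum.
  rewrite mem_map ?mem_enum ?inE; last by move=> ? ? [].
  by case: mapP => [[]|]; rewrite ?orbF.
rewrite mem_map ?mem_enum ?inE; last by move=> ? ? [].
by case: mapP => [[]|]; rewrite ?orbF.
Qed.

Section Correspondence.

Variables (E1 E2 : finType) (C : matroid (E1 + E2)%type) (M : matroid E1).

Definition glue (A : {set E1}) (B : {set E2}) : {set E1 + E2} :=
  [set x | match x with inl e => e \in A | inr e => e \in B end].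

Lemma preim_inl_glue A B : inl @^-1: glue A B = A.
Proof. by apply/setP => x; rewrite !inE. Qed.

Lemma preim_inr_glue A B : inr @^-1: glue A B = B.
Proof. by apply/setP => x; rewrite !inE. Qed.

Lemma card_glue A B : #|glue A B| = #|A| + #|B|.
Proof. by rewrite card_sum_preim preim_inl_glue preim_inr_glue. Qed.

Lemma glue_preim (X : {set E1 + E2}) : glue (inl @^-1: X) (inr @^-1: X) = X.
Proof. by apply/setP => -[x|x]; rewrite !inE. Qed.

Local Notation N := (dsum M (boolean_matroid E2)).

Lemma base_dsum_boolean (B : {set E1 + E2}) :
  base N B -> base M (inl @^-1: B) /\ inr @^-1: B = setT.
Proof.
move=> /maxsetP [/andP [/= iB _] max_B]; split.
  apply/maxsetP; split=> // A iA BA.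
  have <- : glue A (inr @^-1: B) = B; last exact/esym/preim_inl_glue.
  apply: max_B; first by apply/andP; rewrite /= preim_inl_glue.
  apply/subsetP => -[x|x]; rewrite !inE // => xB.
  by apply: (subsetP BA); rewrite inE.
have <- : glue (inl @^-1: B) setT = B; last exact: preim_inr_glue.
apply: max_B; first by apply/andP; rewrite /= preim_inl_glue.
by apply/subsetP => -[x|x]; rewrite !inE.
Qed.

Lemma base_dsum_booleanI A : base M A -> base N (glue A setT).
Proof.
move=> bA; have [D bD] := base_exists N.
have [bD1 eD2] := base_dsum_boolean bD.
apply: (indep_card_base bD).
  by apply/andP; rewrite /= preim_inl_glue base_indep.
by rewrite card_sum_preim eD2 card_glue leq_add2r (card_base bD1 bA).
Qed.

Lemma card_base_cap A (B X : {set E1 + E2}) :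
  inl @^-1: B = A -> inr @^-1: B = setT ->
  #|B :&: X| + #|A :|: inl @^-1: X| = #|A| + #|X|.
Proof.
move=> <- eB; rewrite [#|B :&: X|]card_sum_preim !preimsetI eB setTI.
rewrite [#|X|]card_sum_preim -addnA [#|_| + #|_ :|: _|]addnC addnA.
by rewrite [#|_ :&: _| + _]addnC cardsUI addnA.
Qed.

(** Bases of the intersection are the minimal sets among (A + E2) /\ B, where A
    and B are bases of [M] and [C]. By [card_base_cap] such an intersection is
    smallest when the union of A and the trace of B on E1 is largest. *)
Lemma corr_indepP (J : {set E2}) : indep (corr C M) J <->
  exists A B, [/\ base M A, base C B, J \subset inr @^-1: B &
    forall A' B', base M A' -> base C B' ->
      #|A' :|: inl @^-1: B'| <= #|A :|: inl @^-1: B|].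
Proof.
set U := munion (dual N) (dual C).
(* A set is independent in the union of the duals exactly when it avoids some
   (A + E2) /\ B. *)
have capU A B : base M A -> base C B -> indep U (~: (glue A setT :&: B)).
  move=> bA bB; apply/union_indepP; exists (~: glue A setT), (~: B).
  split; last by rewrite setCI.
    by apply: base_indep; rewrite base_dual setCK base_dsum_booleanI.
  by apply: base_indep; rewrite base_dual setCK.
have Ucap D : indep U D -> exists A B, [/\ base M A, base C B &
    D \subset ~: (glue A setT :&: B)].
  case/union_indepP => I [I' [/dual_indepP [B bB dIB] /dual_indepP [B' bB' dIB']]].
  move=> ->; have [bA eB2] := base_dsum_boolean bB.
  exists (inl @^-1: B), B'; split=> //.
  by rewrite -eB2 glue_preim setCI setUSS // -disjoints_subset.
have card_cap A B : #|glue A setT :&: B| + #|A :|: inl @^-1: B| = #|A| + #|B|.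
  by apply: card_base_cap; rewrite ?preim_inl_glue ?preim_inr_glue.
have disjJ A (B : {set E1 + E2}) :
    [disjoint inr @: J & ~: (glue A setT :&: B)] = (J \subset inr @^-1: B).
  rewrite disjoints_subset setCK -sub_imset_pre; apply/subsetP/subsetP => JB x xJ.
    by have := JB x xJ; rewrite inE => /andP [].
  by rewrite inE JB // andbT; case/imsetP: xJ => y _ ->; rewrite !inE.
split=> [/dual_indepP [D bD dJD]|[A [B [bA bB JB maxAB]]]].
  have [A [B [bA bB DAB]]] := Ucap _ (base_indep bD).
  have eD : D = ~: (glue A setT :&: B).
    case/maxsetP: (bD) => _ max_D; apply/esym/max_D => //; exact: capU.
  exists A, B; split=> //; first by rewrite -(disjJ A) -eD.
  move=> A' B' bA' bB'; have := indep_leq_base bD (capU _ _ bA' bB').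
  have := cardsC (glue A setT :&: B); have := cardsC (glue A' setT :&: B').
  have := card_cap A B; have := card_cap A' B'.
  rewrite eD (card_base bA bA') (card_base bB bB'); lia.
apply/dual_indepP; exists (~: (glue A setT :&: B)); last by rewrite disjJ.
have [D bD] := base_exists U; apply: (indep_card_base bD); first exact: capU.
have [A' [B' [bA' bB' DAB]]] := Ucap _ (base_indep bD).
apply: leq_trans (subset_leq_card DAB) _.
have := cardsC (glue A setT :&: B); have := cardsC (glue A' setT :&: B').
have := card_cap A B; have := card_cap A' B'; have := maxAB _ _ bA' bB'.
rewrite (card_base bA bA') (card_base bB bB'); lia.
Qed.

(** The independent sets of the union of [C] and of [M], the elements of [E2]
    being loops of [M]. *)
Definition union_split (X : {set E1 + E2}) : bool :=
  [exists I : {set E1},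
    [&& inl @: I \subset X, indep C (X :\: inl @: I) & indep M I]].

Lemma union_split_bases A B : base M A -> base C B ->
  union_split (glue (A :|: inl @^-1: B) (inr @^-1: B)).
Proof.
move=> bA bB; apply/existsP; exists (A :\: inl @^-1: B); apply/and3P; split.
- apply/subsetP => _ /imsetP [e eA ->]; move: eA.
  by rewrite !inE => /andP [_ ->].
- apply: indepS (base_indep bB); apply/subsetP => -[x|x]; last by rewrite !inE => /andP [].
  rewrite !inE (mem_imset _ _ (@inl_inj E1 E2)) !inE.
  by case: (inl x \in B); rewrite ?orbT //= orbF andNb.
- exact: indepS (subsetDl _ _) (base_indep bA).
Qed.

Lemma union_splitP X : union_split X -> exists A B, [/\ base M A, base C B,
  inl @^-1: X \subset A :|: inl @^-1: B & inr @^-1: X \subset inr @^-1: B].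
Proof.
case/existsP => I /and3P [IX /indep_sub_base [B bB XB]].
case/indep_sub_base => A bA IA; exists A, B; split=> //; apply/subsetP => x.
  rewrite !inE => xX; have [xI|xI] := boolP (x \in I).
    by rewrite (subsetP IA).
  by rewrite (subsetP XB) ?orbT // inE xX (mem_imset _ _ (@inl_inj E1 E2)) xI.
rewrite !inE => xX; apply: (subsetP XB); rewrite inE xX andbT.
by apply/negP => /imsetP [].
Qed.

(** Both descriptions select bases A of [M] and B of [C] whose union on E1 is as
    large as possible: such a union is a basis of E1 in the matroid union, and
    contracting E1 amounts to adjoining that basis. *)
Lemma corr_represents (T : eqType) (cl : seq T -> T -> Prop) (a : E1 + E2 -> T) :
  pregeometry cl -> (forall X, union_split X <-> indset cl a X) ->
  represents (contraction cl (img (a \o inl) setT)) (a \o inr) (corr C M).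
Proof.
move=> clP splitP J.
pose P1 (A : {set E1}) := union_split (glue A set0).
have P10 : P1 set0.
  apply/splitP; have -> : glue set0 set0 = set0 :> {set E1 + E2}.
    by apply/setP => -[x|x]; rewrite !inE.
  by rewrite /indset /img enum_set0.
case: (@arg_maxnP _ set0 P1 (fun A : {set E1} => #|A|) P10) => I PI max_I.
have img_sum (A : {set E1}) (B : {set E2}) :
    perm_eq (img a (glue A B)) (img (a \o inr) B ++ img (a \o inl) A).
  by have := perm_img_sum a (glue A B); rewrite preim_inl_glue preim_inr_glue.
have key A : P1 A -> (forall A', P1 A' -> #|A'| <= #|A|) ->
    indset (contraction cl (img (a \o inl) setT)) (a \o inr) J <->
    union_split (glue A J).
  move=> /splitP PA max_A.
  have iA : independent cl (img (a \o inl) A).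
    move: PA => /(ind_perm clP (img_sum A set0)).
    by rewrite {1}/img enum_set0.
  have clA x : x \in img (a \o inl) setT -> cl (img (a \o inl) A) x.
    case/imgP => e _ ->; apply: (indset_max clP iA (subsetT _)) (in_setT e).
    move=> A' iA' _; apply: max_A; apply/splitP.
    have := img_sum A' set0; rewrite {2}/img enum_set0 perm_sym => pA.
    exact: (ind_perm clP pA).
  rewrite /indset (ind_contraction _ clP iA (img_sub (subsetT _)) clA).
  rewrite splitP; have pA := img_sum A J; split; last exact: (ind_perm clP).
  by rewrite perm_sym in pA; apply: (ind_perm clP).
have P1_bases A B : base M A -> base C B -> P1 (A :|: inl @^-1: B).
  move=> bA bB; apply/splitP.
  apply: (@indsetS _ _ _ _ clP _ (glue (A :|: inl @^-1: B) (inr @^-1: B))).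
    by apply/subsetP => -[x|x]; rewrite !inE.
  by apply/splitP; apply: union_split_bases.
rewrite corr_indepP; split=> [[A [B [bA bB JB maxAB]]]|].
  apply/(key _ (P1_bases _ _ bA bB)).
    move=> A' /union_splitP [A0 [B0 [bA0 bB0]]]; rewrite preim_inl_glue.
    by move=> /subset_leq_card/leq_trans + _; apply; apply: maxAB.
  apply/splitP; apply: (@indsetS _ _ _ _ clP); last first.
    by apply/splitP; apply: (union_split_bases bA bB).
  apply/subsetP => -[x|x]; rewrite !inE // => xJ.
  by have := subsetP JB x xJ; rewrite inE.
move/(key _ PI max_I) => /union_splitP [A [B [bA bB]]].
rewrite preim_inl_glue preim_inr_glue => IAB JB; exists A, B; split=> //.
move=> A' B' bA' bB'; apply: leq_trans (subset_leq_card IAB).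
exact/max_I/P1_bases.
Qed.
End Correspondence.

(** * Realizing matroid unions *)

Definition infinite (X : eqType) : Prop := forall s : seq X, exists x, x \notin s.

Lemma avoid_bad (X : eqType) (I : finType) (bad : I -> X -> Prop) :
  infinite X -> (forall i n m, bad i n -> bad i m -> n = m) ->
  exists n, forall i, ~ bad i n.
Proof.
move=> infX bad1.
suff [s sP] : exists s : seq X, forall i, i \in enum I -> forall n, bad i n -> n \in s.
  have [n ns] := infX s; exists n => i bn; case/negP: ns.
  by apply: (sP i); rewrite ?mem_enum.
elim: (enum I) => [|i r [s sP]]; first by exists [::].
have [[n bn]|nb] := EM (exists n, bad i n).
  exists (n :: s) => j; rewrite inE => /predU1P [-> m bm|jr m /(sP j jr) ms].
    by rewrite (bad1 _ _ _ bm bn) mem_head.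
  by rewrite inE ms orbT.
exists s => j; rewrite inE => /predU1P [-> m bm|/sP //].
by case: nb; exists m.
Qed.

(** [mix n x y] for varying [n] is a pencil of elements spanned by [x] and [y], two
    of which suffice to recover both; it plays the role of [x + n *: y]. *)
Record mixing (X T : eqType) (cl : seq T -> T -> Prop) (mix : X -> T -> T -> T) :
    Prop := Mixing {
  mix_cl : forall n s x y, cl s x -> cl s y -> cl s (mix n x y);
  mix_inj : forall n m s x y, n != m ->
    cl s (mix n x y) -> cl s (mix m x y) -> cl s x /\ cl s y
}.

Lemma indset_comp (E F : finType) (T : eqType) (cl : seq T -> T -> Prop)
    (f : E -> F) (a : F -> T) (S : {set E}) : pregeometry cl -> injective f ->
  indset cl a (f @: S) <-> indset cl (a \o f) S.
Proof.
move=> clP inj_f; have p : perm_eq (img a (f @: S)) (img (a \o f) S).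
  rewrite /img (map_comp a f); apply: perm_map; apply: uniq_perm.
  - exact: enum_uniq.
  - by rewrite map_inj_uniq ?enum_uniq.
  move=> x; rewrite mem_enum; apply/imsetP/mapP => -[y].
    by exists y; rewrite ?mem_enum.
  by rewrite mem_enum; exists y.
split; first exact: (ind_perm clP).
by rewrite perm_sym in p; apply: (ind_perm clP).
Qed.

Section Union.

Variables (E1 E2 : finType) (X T : eqType) (cl : seq T -> T -> Prop).
Variables (mix : X -> T -> T -> T) (C : matroid (E1 + E2)%type) (M : matroid E1).
Hypotheses (clP : pregeometry cl) (mixP : mixing cl mix) (infX : infinite X).

Local Notation G := ((E1 + E2) + E1)%type.
Local Notation old e := (inl (inl e) : G).
Local Notation new e := (inr e : G).

(** The trade-off between the two matroids: the elements of [I] are taken from the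
    copy of [E1] that carries [M] instead of the one that carries [C]. *)
Definition moved (I : {set E1}) (S : {set G}) : {set G} :=
  (S :\: [set old e | e in I]) :|: [set new e | e in I].

Lemma mem_moved_old I S e :
  (old e \in moved I S) = (e \notin I) && (old e \in S).
Proof.
rewrite !inE mem_imset; last by move=> ? ? [].
by case: imsetP => [[]|] //; rewrite orbF.
Qed.

Lemma mem_moved_mid I S (e : E2) : (inl (inr e) \in moved I S) = (inl (inr e) \in S).
Proof.
by rewrite !inE; case: imsetP => [[]|] //; case: imsetP => [[]|] //; rewrite orbF.
Qed.

Lemma mem_moved_new I S e : (new e \in moved I S) = (e \in I) || (new e \in S).
Proof.
rewrite !inE; case: imsetP => [[]|] // _ /=.
by rewrite mem_imset ?[_ || (e \in I)]orbC // => ? ? [].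
Qed.

Definition mem_moved := (mem_moved_old, mem_moved_mid, mem_moved_new).

(** The mixtures are made one element at a time. Outside any given flat at least
    one of [x] and [y] lies if and only if the mixture does, as soon as the index
    avoids one bad value for each of the finitely many flats. So a set that
    contains the mixture is independent if and only if it is so with [x] or with
    [y] in its place. *)
Lemma union_mix_seq (c : G -> T) (s : seq E1) : uniq s ->
  exists d : G -> T, forall S : {set G}, (forall e, e \in s -> new e \notin S) ->
    (indset cl d S <-> exists I : {set E1},
      [/\ {subset I <= s}, forall e, e \in I -> old e \in S
        & indset cl c (moved I S)]).
Proof.
elim: s => [_|e s IHs /= /andP [es us]].
  exists c => S _; have e0 : moved set0 S = S.
    by rewrite /moved !imset0 setD0 setU0.
  split=> [iS|[I [I0 _]]].
    by exists set0; rewrite e0; split=> // x; rewrite inE.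
  have -> : I = set0 by apply/setP => x; rewrite inE; apply/negP => /I0.
  by rewrite e0.
have {IHs us} [d dP] := IHs us.
pose x := d (old e); pose y := d (new e).
(* The indices whose mixture lies in the flat spanned by A although x and y do not
   both: there is at most one by [mix_inj]. *)
pose bad (A : {set G}) n :=
  cl (img d A) (mix n x y) /\ ~ (cl (img d A) x /\ cl (img d A) y).
have [|n nbad] := @avoid_bad _ _ bad infX.
  move=> A m p [cm nxy] [cp _]; apply/eqP; apply: contra_notT nxy => mp.
  exact: (mix_inj mixP mp cm cp).
pose d' g := if g == old e then mix n x y else d g.
have img_d' (S : {set G}) : old e \notin S -> img d' S = img d S.
  move=> eS; apply/eq_in_map => g; rewrite mem_enum /d' => gS.
  by rewrite (negPf (memPn eS _ gS)).
exists d' => S S_new.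
have Ss f : f \in s -> new f \notin S by move=> fs; rewrite S_new // inE fs orbT.
have [eS|eS] := boolP (old e \in S); last first.
  rewrite /indset img_d' // -/(indset cl d S) dP //; split=> -[I [Is IS iI]].
    by exists I; split=> // f /Is; rewrite inE orbC => ->.
  exists I; split=> // f fI; have := Is _ fI; rewrite inE => /predU1P [ef|//].
  by rewrite -ef (IS _ fI) in eS.
pose Y := S :\ old e; have eY : old e \notin Y by rewrite setD11.
have neS : new e \notin S by apply: S_new; rewrite mem_head.
have neY : new e \notin Y by rewrite !inE (negPf neS).
have step : indset cl d' S <-> indset cl d S \/ indset cl d (new e |: Y).
  rewrite -(setD1K eS) -/Y !indsetU1 //.
  rewrite /indset img_d' // -/(indset cl d Y) {1}/d' eqxx -/x -/y.
  split=> [[nmix iY]|[[nx iY]|[ny iY]]].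
  - have [cx|nx] := EM (cl (img d Y) x); last by left.
    by right; split=> // cy; case: nmix; apply: (mix_cl mixP).
  - split=> // cmix; apply: (nbad Y); split=> //.
    by case.
  - split=> // cmix; apply: (nbad Y); split=> //.
    by case.
rewrite step dP // dP; last first.
  move=> f fs; rewrite !inE (negPf (Ss _ fs)) andbF orbF.
  by apply/eqP => -[ef]; rewrite -ef fs in es.
have movedU (I : {set E1}) : e \notin I -> moved (e |: I) S = moved I (new e |: Y).
  move=> eI; apply/setP => -[[g|g]|g]; rewrite !mem_moved !inE /=.
  - by rewrite negb_or; case: (eqVneq g e) => [->|ne] /=;
      rewrite ?eqxx ?andbF // (inj_eq inl_inj) (inj_eq inl_inj) ne.
  - by [].
  - by rewrite (inj_eq inr_inj) orbCA orbA.
split=> [[[I [Is IS iI]]|[I [Is IS iI]]]|[I [Is IS iI]]].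
- by exists I; split=> // f /Is; rewrite inE orbC => ->.
- have eI : e \notin I by apply: contra es => /Is.
  exists (e |: I); rewrite movedU //; split=> // f; rewrite !inE.
    by case/predU1P => [->|/Is ->]; rewrite ?eqxx ?orbT.
  by case/predU1P => [-> //|/IS]; rewrite !inE /= => /andP [].
- have [eI|eI] := boolP (e \in I); last first.
    left; exists I; split=> // f fI; have := Is _ fI.
    by rewrite inE => /predU1P [ef|//]; rewrite -ef fI in eI.
  right; exists (I :\ e); rewrite -movedU ?setD11 // setD1K //; split=> // f.
    by rewrite !inE => /andP [nfe /Is]; rewrite inE (negPf nfe).
  rewrite !inE => /andP [nfe /IS ->].
  by rewrite /= (inj_eq inl_inj) (inj_eq inl_inj) nfe.
Qed.

Lemma union_mix (c : G -> T) : represents cl c (dsum C M) ->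
  exists a : E1 + E2 -> T, forall S, union_split C M S <-> indset cl a S.
Proof.
move=> cP; have [d dP] := union_mix_seq c (enum_uniq E1).
exists (d \o inl) => S; rewrite -indset_comp //; last exact: inl_inj.
rewrite dP; last by move=> e _; apply/negP => /imsetP [].
have movedE (I : {set E1}) : inl @: I \subset S ->
    indset cl c (moved I (inl @: S)) <-> indep C (S :\: inl @: I) && indep M I.
  move=> IS; rewrite -cP /= /dsum_indep.
  suff [-> ->] : inl @^-1: moved I (inl @: S) = S :\: inl @: I /\
                 inr @^-1: moved I (inl @: S) = I by [].
  split; apply/setP; last first.
    move=> e; rewrite inE mem_moved.
    by case: imsetP => [[]|]; rewrite ?orbF.
  move=> [e|e]; rewrite inE mem_moved ?inE !(mem_imset _ _ (@inl_inj _ _)) //.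
  by case: imsetP => [[]|].
split=> [/existsP [I /and3P [IS iC iM]]|[I [_ IS iI]]].
  exists I; split=> [e _|e eI|]; first by rewrite mem_enum.
    by rewrite imset_f // (subsetP IS) ?imset_f.
  by apply/movedE; rewrite ?iC.
have IS' : inl @: I \subset S.
  apply/subsetP => _ /imsetP [e eI ->].
  by have := IS _ eI; rewrite (mem_imset _ _ (@inl_inj _ _)).
by apply/existsP; exists I; rewrite IS' /=; apply/movedE.
Qed.

End Union.

(** * Linear closure *)

Import GRing.Theory.
Local Open Scope ring_scope.

Section Linear.

Variable K : fieldType.
Implicit Type V : vectType K.

Definition lin V (s : seq V) (x : V) : Prop := x \in <<s>>%VS.

Lemma lin_pregeometry V : pregeometry (@lin V).
Proof.
rewrite /lin; split=> [s x|s u x su|s x y]; first exact: memv_span.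
  by apply: subvP; apply/span_subvP.
rewrite span_cons => /memv_addP [_ /vlineP [k ->] [w ws ey]] ny.
have k0 : k != 0.
  by apply: contra_notN ny => /eqP k0; rewrite ey k0 scale0r add0r.
have -> : x = k^-1 *: (y - w) by rewrite ey addrK scalerA mulVf // scale1r.
apply/rpredZ/rpredB; first by rewrite memv_span ?mem_head.
by rewrite span_cons (subvP (addvSr _ _)).
Qed.

Lemma ind_lin V (s : seq V) : independent (@lin V) s <-> free s.
Proof.
elim: s => [|x s IHs] /=; first by rewrite nil_free.
by rewrite free_cons IHs /lin; split=> [[/negP -> ->] //|/andP [/negP]].
Qed.

Lemma representableP (E : finType) (M : matroid E) :
  representable_matroid K M <->
  exists n (v : E -> 'rV[K]_n), represents (@lin _) v M.
Proof.
split=> -[n [v vP]]; exists n, v => S; first by rewrite vP /indset ind_lin.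
by apply/idP/idP => [/vP/ind_lin|/ind_lin/vP].
Qed.

Lemma lin_mixing V : mixing (@lin V) (fun (k : K) x y => x + k *: y).
Proof.
rewrite /lin; split=> [k s x y xs ys|k l s x y nkl ck cl].
  by rewrite rpredD ?rpredZ.
have ys : y \in <<s>>%VS.
  have <- : (k - l)^-1 *: ((x + k *: y) - (x + l *: y)) = y.
    by rewrite opprD addrACA subrr add0r -scalerBl scalerA mulVf ?scale1r ?subr_eq0.
  by rewrite rpredZ ?rpredB.
by split=> //; rewrite -(addrK (k *: y) x) rpredB ?rpredZ.
Qed.

(** The quotient by the span of [X], realized inside the same space by the
    projection onto a complement. *)
Lemma lin_contraction V (X : seq V) : exists f : V -> V,
  forall s x, contraction (@lin V) X s x <-> lin (map f s) (f x).
Proof.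
pose f := (\1 - projv <<X>>)%VF; exists f => s x.
have fE y : f y = y - projv <<X>> y by rewrite !lfunE /= !lfunE.
have fX y : y \in <<X>>%VS -> f y = 0 by move=> yX; rewrite fE projv_id ?subrr.
rewrite /contraction /lin span_cat -limg_span; split.
  case/memv_addP => y /fX fy [z zs ->]; rewrite linearD /= fy add0r.
  exact: memv_img.
case/memv_imgP => z zs fxz; rewrite -(subrK z x).
apply: memv_add zs; have : f (x - z) = 0 by rewrite linearB /= fxz subrr.
by rewrite fE => /eqP; rewrite subr_eq0 => /eqP ->; apply: memv_proj.
Qed.

Lemma free_map_lker0 (V W : vectType K) (f : 'Hom(V, W)) (s : seq V) :
  lker f == 0%VS -> free (map f s) = free s.
Proof.
by move=> kf; rewrite /free -limg_span limg_dim_eq ?size_map // (eqP kf) capv0.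
Qed.

Lemma representable_dsum (E F : finType) (M : matroid E) (N : matroid F) :
  representable_matroid K M -> representable_matroid K N ->
  exists n (c : E + F -> 'rV[K]_n), represents (@lin _) c (dsum M N).
Proof.
case=> m [v vP] [n [w wP]]; exists (m + n)%N.
exists (fun g => match g with inl e => row_mx (v e) 0 | inr e => row_mx 0 (w e) end).
set c := (X in represents _ X) => S; rewrite /indset /= /dsum_indep.
pose fl : 'Hom('rV[K]_m, 'rV[K]_(m + n)) := linfun (mulmxr (row_mx 1%:M 0)).
pose fr : 'Hom('rV[K]_n, 'rV[K]_(m + n)) := linfun (mulmxr (row_mx 0 1%:M)).
have flE x : fl x = row_mx x 0 by rewrite lfunE /= mul_mx_row mulmx1 mulmx0.
have frE x : fr x = row_mx 0 x by rewrite lfunE /= mul_mx_row mulmx1 mulmx0.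
have fl0 : lker fl == 0%VS.
  by apply/lker0P => x y; rewrite !flE => /eq_row_mx [].
have fr0 : lker fr == 0%VS.
  by apply/lker0P => x y; rewrite !frE => /eq_row_mx [].
have dir (s : seq 'rV_m) (u : seq 'rV_n) :
    directv (<<map fr u>> + <<map fl s>>)%VS.
  apply/directv_addP/eqP; rewrite -subv0; apply/subvP => z.
  rewrite -!limg_span => /memv_capP [/memv_imgP [x _ ->] /memv_imgP [y _]].
  by rewrite flE frE => /eq_row_mx [_ ->]; rewrite row_mx0 mem0v.
have img_l : img (c \o inl) (inl @^-1: S) = map fl (img v (inl @^-1: S)).
  by rewrite /img -map_comp; apply: eq_map => e /=; rewrite flE.
have img_r : img (c \o inr) (inr @^-1: S) = map fr (img w (inr @^-1: S)).
  by rewrite /img -map_comp; apply: eq_map => e /=; rewrite frE.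
have := perm_img_sum c S; rewrite img_l img_r ind_lin => /perm_free ->.
by rewrite cat_free !free_map_lker0 // dir andbT andbC vP wP.
Qed.

End Linear.

(** * Algebraic closure *)

Section Adjoin.

Variables (K L : fieldType) (iota : {rmorphism K -> L}).
Implicit Types (A B : L -> Prop).

(** The subfield generated by [A] as a boolean predicate and then as a type, so that
    the theory of integral elements applies over it. *)
Definition adjoin_pred A : {pred L} := fun x => `[< adjoin iota A x >].

Lemma adjoin_predP A x : reflect (adjoin iota A x) (x \in adjoin_pred A).
Proof. exact: asboolP. Qed.

Fact adjoin_divring_closed A : GRing.divring_closed (adjoin_pred A).
Proof.
split=> [|x y|x y]; try (move=> /adjoin_predP Ax /adjoin_predP Ay).
- by apply/adjoin_predP; rewrite -(rmorph1 iota); apply: adjoin_base.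
- by apply/adjoin_predP; apply: adjoinD => //; apply: adjoinN.
- by apply/adjoin_predP; apply: adjoinM => //; apply: adjoinV.
Qed.

HB.instance Definition _ A :=
  GRing.isDivringClosed.Build L (adjoin_pred A) (adjoin_divring_closed A).

Record adjoin_field A := AdjoinField {
  adjoin_val :> L; _ : adjoin_val \in adjoin_pred A }.

HB.instance Definition _ A := [isSub for @adjoin_val A].
HB.instance Definition _ A := [Choice of adjoin_field A by <:].
HB.instance Definition _ A := [SubChoice_isSubIntegralDomain of adjoin_field A by <:].
HB.instance Definition _ A := [SubIntegralDomain_isSubField of adjoin_field A by <:].

Lemma algebraic_eltE A x :
  algebraic_elt (adjoin iota A) x <-> algebraicOver (\val : adjoin_field A -> L) x.
Proof.
split=> [[p [p0 Ap px]]|[p p0 px]]; last first.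
  exists (map_poly \val p); split=> // [|i]; first by rewrite map_poly_eq0.
  by rewrite coef_map; apply/adjoin_predP/valP.
pose q : {poly adjoin_field A} := \poly_(i < size p) insubd 0 p`_i.
have qE : map_poly \val q = p.
  apply/polyP => i; rewrite coef_map coef_poly.
  case: ltnP => [_|le_i]; last first.
    by rewrite nth_default //; apply: (rmorph0 (\val : {rmorphism adjoin_field A -> L})).
  by apply: insubdK; apply/adjoin_predP.
by exists q; rewrite ?qE // -(map_poly_eq0 (\val : adjoin_field A -> L)) qE.
Qed.

Lemma algebraic_adjoin A x : adjoin iota A x -> algebraic_elt (adjoin iota A) x.
Proof.
move=> Ax; apply/algebraic_eltE; have xP : x \in adjoin_pred A by apply/adjoin_predP.
by have := algebraic_id (\val : adjoin_field A -> L) (AdjoinField xP).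
Qed.

Lemma algebraic_adjoin_closed A B x :
  (forall y, A y -> algebraic_elt (adjoin iota B) y) -> adjoin iota A x ->
  algebraic_elt (adjoin iota B) x.
Proof.
move=> AB Ax; apply/algebraic_eltE.
elim: Ax => {x} [c|x /AB /algebraic_eltE //|x y _ + _|x _|x y _ + _|x _].
- by apply/algebraic_eltE/algebraic_adjoin/adjoin_base.
- exact: algebraic_add.
- exact: algebraic_opp.
- exact: algebraic_mul.
- exact: algebraic_inv.
Qed.

(** Transitivity of algebraicity, from the corresponding fact on integrality. *)
Lemma algebraic_root B p x : p != 0 -> root p x ->
  (forall i, algebraic_elt (adjoin iota B) p`_i) ->
  algebraic_elt (adjoin iota B) x.
Proof.
move=> p0 px Bp; apply/algebraic_eltE/integral_algebraic.
apply: (integral_root p0 px); apply/integral_poly => i.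
exact/integral_algebraic/algebraic_eltE.
Qed.

Lemma algebraic_trans A B x :
  (forall y, A y -> algebraic_elt (adjoin iota B) y) ->
  algebraic_elt (adjoin iota A) x -> algebraic_elt (adjoin iota B) x.
Proof.
move=> AB [p [p0 Ap px]]; apply: (algebraic_root p0 px) => i.
exact: algebraic_adjoin_closed (Ap i).
Qed.

(** The subring K[A]. Polynomial relations over it can be carried along ring
    morphisms, unlike relations over the field K(A). *)
Inductive ring_gen A : L -> Prop :=
| ring_gen_base c : ring_gen A (iota c)
| ring_gen_gen x : A x -> ring_gen A x
| ring_genD x y : ring_gen A x -> ring_gen A y -> ring_gen A (x + y)
| ring_genM x y : ring_gen A x -> ring_gen A y -> ring_gen A (x * y).

Lemma ring_gen0 A : ring_gen A 0.
Proof. by rewrite -(rmorph0 iota); apply: ring_gen_base. Qed.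

Lemma ring_gen1 A : ring_gen A 1.
Proof. by rewrite -(rmorph1 iota); apply: ring_gen_base. Qed.

Lemma ring_genN A x : ring_gen A x -> ring_gen A (- x).
Proof.
rewrite -mulN1r; apply: ring_genM.
by rewrite -(rmorph1 iota) -rmorphN; apply: ring_gen_base.
Qed.

Lemma ring_gen_adjoin A x : ring_gen A x -> adjoin iota A x.
Proof.
elim=> {x} [c|x|x y _ + _|x y _ + _]; first exact: adjoin_base.
- exact: adjoin_gen.
- exact: adjoinD.
- exact: adjoinM.
Qed.

Lemma adjoin_frac A x : adjoin iota A x ->
  exists a b, [/\ ring_gen A a, ring_gen A b, b != 0 & x = a / b].
Proof.
elim=> {x} [c|x Ax|x y _ [a [b [Aa Ab b0 ->]]] _ [c [d [Ac Ad d0 ->]]]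
           |x _ [a [b [Aa Ab b0 ->]]]
           |x y _ [a [b [Aa Ab b0 ->]]] _ [c [d [Ac Ad d0 ->]]]
           |x _ [a [b [Aa Ab b0 ->]]]].
- exists (iota c), 1; rewrite divr1 oner_neq0.
  by split=> //; [apply: ring_gen_base|apply: ring_gen1].
- exists x, 1; rewrite divr1 oner_neq0.
  by split=> //; [apply: ring_gen_gen|apply: ring_gen1].
- exists (a * d + c * b), (b * d); rewrite addf_div // mulf_neq0 //.
  by split=> //; [apply: ring_genD|]; apply: ring_genM.
- by exists (- a), b; rewrite mulNr; split=> //; apply: ring_genN.
- exists (a * c), (b * d); rewrite mulf_div mulf_neq0 //.
  by split=> //; apply: ring_genM.
- have [->|a0] := eqVneq a 0.
    exists 0, 1; rewrite !mul0r invr0 oner_neq0.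
    by split=> //; [apply: ring_gen0|apply: ring_gen1].
  by exists b, a; rewrite invf_div.
Qed.

Lemma common_denominator A (s : seq L) : (forall x, x \in s -> adjoin iota A x) ->
  exists2 d, ring_gen A d & d != 0 /\ forall x, x \in s -> ring_gen A (d * x).
Proof.
elim: s => [_|x s IHs sP].
  by exists 1; [apply: ring_gen1|rewrite oner_neq0].
have [y ys|d Ad [d0 ds]] := IHs _; first by apply: sP; rewrite inE ys orbT.
have [a [b [Aa Ab b0 ex]]] := adjoin_frac (sP x (mem_head _ _)).
exists (d * b); first exact: ring_genM.
split=> [|y]; first by rewrite mulf_neq0.
rewrite inE => /predU1P [->|ys]; last first.
  by rewrite mulrAC; apply: ring_genM => //; apply: ds.
by rewrite ex -mulrA [b * _]mulrC divfK //; apply: ring_genM.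
Qed.

(** Clearing denominators. *)
Lemma algebraic_ring_gen A x :
  algebraic_elt (adjoin iota A) x <-> algebraic_elt (ring_gen A) x.
Proof.
split=> -[p [p0 Ap px]]; last first.
  by exists p; split=> // i; apply: ring_gen_adjoin.
have [|d Ad [d0 dp]] := @common_denominator A p.
  by move=> _ /(nthP 0) [i _ <-].
exists (d *: p); split; first by rewrite scaler_eq0 negb_or d0.
  move=> i; rewrite coefZ; have [lt_i|le_i] := ltnP i (size p).
    by apply: dp; apply: mem_nth.
  by rewrite nth_default // mulr0; apply: ring_gen0.
by rewrite rootZ.
Qed.

Definition acl (s : seq L) (x : L) : Prop :=
  algebraic_elt (adjoin iota (fun y => y \in s)) x.

Definition coefs_in (R : nzSemiRingType) (P : R -> Prop) (p : {poly R}) : Prop :=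
  forall i, P p`_i.

Lemma ring_gen_cons x s z : ring_gen (fun y => y \in x :: s) z ->
  exists2 q, coefs_in (ring_gen (fun y => y \in s)) q & z = q.[x].
Proof.
have polyC_gen c : ring_gen (fun y => y \in s) c ->
    coefs_in (ring_gen (fun y => y \in s)) c%:P.
  by move=> sc i; rewrite coefC; case: eqP => // _; apply: ring_gen0.
elim=> {z} [c|z|z w _ [p sp ->] _ [q sq ->]|z w _ [p sp ->] _ [q sq ->]].
- by exists (iota c)%:P; rewrite ?hornerC //; apply/polyC_gen/ring_gen_base.
- rewrite inE => /predU1P [->|zs].
    exists 'X; rewrite ?hornerX // => i; rewrite coefX.
    by case: eqP => _; [apply: ring_gen1|apply: ring_gen0].
  by exists z%:P; rewrite ?hornerC //; apply/polyC_gen/ring_gen_gen.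
- by exists (p + q); rewrite ?hornerD // => i; rewrite coefD; apply: ring_genD.
exists (p * q); rewrite ?hornerM // => i; rewrite coefM.
apply: (big_ind (ring_gen _)) => [|a b|j _]; first exact: ring_gen0.
  exact: ring_genD.
exact: ring_genM.
Qed.

Lemma ring_gen_mono A B x :
  (forall y, A y -> ring_gen B y) -> ring_gen A x -> ring_gen B x.
Proof.
move=> AB; elim=> {x} [c|x /AB //|x y _ + _|x y _ + _].
- exact: ring_gen_base.
- exact: ring_genD.
- exact: ring_genM.
Qed.

Lemma ring_gen_horner A (p : {poly L}) x :
  coefs_in (ring_gen A) p -> ring_gen A x -> ring_gen A p.[x].
Proof.
move=> Ap Ax; rewrite horner_coef.
apply: (big_ind (ring_gen _)) => [|a b|j _]; first exact: ring_gen0.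
  exact: ring_genD.
apply: ring_genM => //; elim: (j : nat) => [|n]; first exact: ring_gen1.
by rewrite exprS; apply: ring_genM.
Qed.

Lemma lift_poly (R S : nzRingType) (f : {rmorphism R -> S}) (P : R -> Prop)
    (p : {poly S}) : P 0 -> (forall i, exists a, P a /\ f a = p`_i) ->
  exists2 q, coefs_in P q & map_poly f q = p.
Proof.
move=> P0 /boolp.choice [h hP]; exists (\poly_(i < size p) h i).
  by move=> i; rewrite coef_poly; case: ifP => // _; apply: (hP i).1.
apply/polyP => i; rewrite coef_map coef_poly; case: ltnP => [_|le_i].
  exact: (hP i).2.
by rewrite nth_default ?raddf0.
Qed.

Lemma acl_mem s x : x \in s -> acl s x.
Proof. by move=> xs; apply/algebraic_adjoin/adjoin_gen. Qed.

Lemma acl_trans s u x : (forall y, y \in s -> acl u y) -> acl s x -> acl u x.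
Proof. exact: algebraic_trans. Qed.

(** A relation P(x, y) = 0 in which y really occurs, read as a polynomial in x with
    coefficients in K[s, y]. It does not vanish identically, for otherwise y would
    be a root of its coefficients, which lie in K[s][Y]. *)
Lemma acl_exchange s x y : acl (x :: s) y -> ~ acl s y -> acl (y :: s) x.
Proof.
move=> /algebraic_ring_gen [p [p0 sp /rootP py]] ny.
have [|i|Q sQ Qp] := @lift_poly _ _ (horner_eval x)
    (coefs_in (ring_gen (fun y => y \in s))) p.
- by move=> i; rewrite coef0; apply: ring_gen0.
- by have [q sq eq_q] := ring_gen_cons (sp i); exists q.
have RE : map_poly (horner_eval y) (swapXY Q) = Q.[y%:P].
  by rewrite -horner_swapXY swapXYK.
apply/algebraic_ring_gen; exists Q.[y%:P]; split.
- apply/negP; rewrite -RE => /eqP R0; apply: ny; apply/algebraic_ring_gen.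
  exists (lead_coef (swapXY Q)); split.
  + by rewrite lead_coef_eq0 swapXY_eq0; apply: contra_neq p0 => Q0;
       rewrite -Qp Q0 rmorph0.
  + by move=> i; rewrite /lead_coef coef_swapXY; apply: sQ.
  + have := congr1 (fun r : {poly L} => r`_(size (swapXY Q)).-1) R0.
    by rewrite coef_map coef0 => /eqP.
- move=> i; rewrite -RE coef_map; apply: ring_gen_horner => [j|].
    rewrite coef_swapXY; apply: ring_gen_mono (sQ j i) => z zs.
    by apply: ring_gen_gen; rewrite inE zs orbT.
  by apply: ring_gen_gen; rewrite mem_head.
- by apply/rootP; rewrite -horner2_swapXY horner_swapXY Qp.
Qed.

Lemma acl_pregeometry : pregeometry acl.
Proof. by split; [exact: acl_mem|exact: acl_trans|exact: acl_exchange]. Qed.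

Lemma acl_ring s x : ring_gen (fun y => acl s y) x -> acl s x.
Proof. by move/ring_gen_adjoin; apply: algebraic_adjoin_closed. Qed.

End Adjoin.

(** * Mixtures, base change and roots *)

(** Powers take the place of scalars, which makes this work over finite fields: if
    [x + y ^+ n.+1] and [x + y ^+ m.+1] are algebraic over K(s), then so is the
    difference, and [y] is a root of the nonconstant trinomial it gives. *)
Lemma acl_mixing (K L : fieldType) (iota : {rmorphism K -> L}) :
  mixing (acl iota) (fun (n : nat) x y => x + y ^+ n.+1).
Proof.
have ring s x := @acl_ring _ _ iota s x.
have gen s x (sx : acl iota s x) := @ring_gen_gen _ _ iota (acl iota s) x sx.
have genX s x n (sx : acl iota s x) : ring_gen iota (acl iota s) (x ^+ n).
  elim: n => [|n IHn]; first exact: ring_gen1.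
  by rewrite exprS; apply: ring_genM => //; apply: gen.
split=> [n s x y sx sy|n m s x y].
  by apply/ring/ring_genD; [apply: gen|apply: genX].
wlog lt_nm : n m / (n < m)%N => [IH|_ cn cm].
  move=> nm cn cm; have := nm; rewrite neq_ltn => /orP [lt|lt].
    exact: (IH n m).
  by apply: (IH m n) => //; rewrite eq_sym.
pose c := (x + y ^+ n.+1) - (x + y ^+ m.+1).
have sc : acl iota s c by apply/ring/ring_genD; [|apply: ring_genN]; apply: gen.
pose p : {poly L} := 'X^(m.+1) - 'X^(n.+1) + c%:P.
have sy : acl iota s y.
  apply: (@algebraic_root _ _ _ _ p).
  - apply/eqP => /(congr1 (fun q : {poly L} => q`_m.+1)).
    rewrite !coefE eqxx gtn_eqF //= subr0 addr0 => /eqP.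
    by rewrite oner_eq0.
  - apply/rootP; rewrite !(hornerD, hornerN, hornerXn, hornerC) /c.
    have -> : y ^+ m.+1 - y ^+ n.+1 = x + y ^+ m.+1 - (x + y ^+ n.+1).
      by rewrite opprD addrACA subrr add0r.
    by rewrite addrA subrK subrr.
  - move=> i; rewrite !coefE; apply: ring.
    have b01 (b : bool) : ring_gen iota (acl iota s) b%:R.
      by case: b; [apply: ring_gen1|apply: ring_gen0].
    apply: ring_genD; first by apply: ring_genD => //; apply: ring_genN.
    by case: ifP => _; [apply: gen|apply: ring_gen0].
split=> //; rewrite -(addrK (y ^+ n.+1) x).
by apply/ring/ring_genD; [apply: gen|apply/ring_genN/genX].
Qed.

Section BaseChange.

Variables (K L L' : fieldType) (iota : {rmorphism K -> L}).
Variables (iota' : {rmorphism K -> L'}) (j : {rmorphism L -> L'}).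
Hypothesis jE : forall c, j (iota c) = iota' c.

Lemma ring_gen_map (A : L -> Prop) (B : L' -> Prop) x :
  (forall y, A y -> B (j y)) -> ring_gen iota A x -> ring_gen iota' B (j x).
Proof.
move=> AB; elim=> {x} [c|x /AB|x y _ + _|x y _ + _]; rewrite ?rmorphD ?rmorphM.
- by rewrite jE; apply: ring_gen_base.
- exact: ring_gen_gen.
- exact: ring_genD.
- exact: ring_genM.
Qed.

Lemma ring_gen_map_inv s z : ring_gen iota' (fun y => y \in map j s) z ->
  exists x, ring_gen iota (fun y => y \in s) x /\ j x = z.
Proof.
elim=> {z} [c|z /mapP [x xs ->]|z w _ [x [sx <-]] _ [y [sy <-]]
           |z w _ [x [sx <-]] _ [y [sy <-]]].
- by exists (iota c); rewrite jE; split=> //; apply: ring_gen_base.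
- by exists x; split=> //; apply: ring_gen_gen.
- by exists (x + y); rewrite rmorphD; split=> //; apply: ring_genD.
- by exists (x * y); rewrite rmorphM; split=> //; apply: ring_genM.
Qed.

Lemma acl_map s x : acl iota' (map j s) (j x) <-> acl iota s x.
Proof.
split=> /algebraic_ring_gen [p [p0 sp px]]; apply/algebraic_ring_gen.
  have [|i|q sq eq_p] := @lift_poly _ _ j (ring_gen iota (fun y => y \in s)) p.
  - exact: ring_gen0.
  - exact: ring_gen_map_inv (sp i).
  exists q; split=> //; first by rewrite -(map_poly_eq0 j) eq_p.
  by rewrite -(fmorph_root j) eq_p.
exists (map_poly j p); rewrite map_poly_eq0 fmorph_root; split=> // i.
rewrite coef_map; apply: ring_gen_map (sp i) => y; exact: map_f.
Qed.

Lemma ind_acl_map s : independent (acl iota') (map j s) <-> independent (acl iota) s.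
Proof. by elim: s => //= x s ->; rewrite acl_map. Qed.

End BaseChange.

Lemma acl_scalars (K F L : fieldType) (k : {rmorphism K -> F})
    (iF : {rmorphism F -> L}) (iK : {rmorphism K -> L}) s x :
  (forall c, iF (k c) = iK c) -> acl iK s x -> acl iF s x.
Proof.
move=> kE [p [p0 sp px]]; exists p; split=> // i.
elim: (sp i) => [c|y|y z _ + _|y _|y z _ + _|y _].
- by rewrite -kE; apply: adjoin_base.
- by move=> ys; apply: adjoin_gen.
- exact: adjoinD.
- exact: adjoinN.
- exact: adjoinM.
- exact: adjoinV.
Qed.

(** A nonconstant divisor of least degree is irreducible. *)
Lemma root_extension (F : fieldType) (p : {poly F}) : (1 < size p)%N ->
  exists (F' : fieldType) (j : {rmorphism F -> F'}) (y : F'), root (map_poly j p) y.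
Proof.
move=> p1; pose P n := `[< exists q : {poly F}, [/\ q %| p, size q = n & (1 < n)%N] >].
have [|n /asboolP [q [qp sq n1]] min_n] := @ex_minnP P.
  by exists (size p); apply/asboolP; exists p.
have p0 : p != 0 by apply: contraTneq p1 => ->; rewrite size_poly0.
have q0 : q != 0 by rewrite -size_poly_eq0 sq; case: (n) n1.
have irr_q : irreducible_poly q.
  split=> [|d d1 dq]; first by rewrite sq.
  have d0 : d != 0 by apply: contraNneq q0 => d0; move: dq; rewrite d0 dvd0p.
  rewrite -dvdp_size_eqp // eqn_leq dvdp_leq // sq min_n //.
  apply/asboolP; exists d; split=> //; first exact: dvdp_trans qp.
  by move: d0 d1; rewrite -size_poly_eq0; case: (size d) => [|[]].
have [F' _ [y qy _]] := irredp_FAdjoin irr_q.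
exists F', (in_alg F'), y; have /dvdpP [r ->] := qp.
by rewrite rmorphM rootM qy orbT.
Qed.

(** * Transcendence degree as rank *)

Lemma rmorph_mpolyE (K : comNzRingType) (S : comNzRingType) n
    (f : {rmorphism {mpoly K[n]} -> S}) p :
  f p = \sum_(m <- msupp p) f (p@_m)%:MP * \prod_i f 'X_i ^+ m i.
Proof.
rewrite {1}[p]mpolyE raddf_sum /=; apply: eq_bigr => m _.
rewrite -mul_mpolyC rmorphM mpolyXE_id rmorph_prod.
by congr (_ * _); apply: eq_bigr => i _; rewrite rmorphXn.
Qed.

Lemma eq_rmorph_mpoly (K : comNzRingType) (S : comNzRingType) n
    (f g : {rmorphism {mpoly K[n]} -> S}) :
  (forall c, f c%:MP = g c%:MP) -> (forall i, f 'X_i = g 'X_i) -> f =1 g.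
Proof.
move=> fgC fgX p; rewrite !rmorph_mpolyE; apply: eq_bigr => m _.
by rewrite fgC; congr (_ * _); apply: eq_bigr => i _; rewrite fgX.
Qed.

Section LastVariable.

Variables (K : comNzRingType) (n : nat).

Let widen (i : 'I_n) : 'I_n.+1 := widen_ord (leqnSn n) i.

Lemma widen_max i : (widen i == ord_max) = false.
Proof. by rewrite -val_eqE /= ltn_eqF. Qed.

Lemma mwiden_X i : mwiden ('X_i : {mpoly K[n]}) = 'X_(widen i).
Proof. by rewrite mwidenX mnmwiden1. Qed.

Lemma muni_Xwiden i : muni ('X_(widen i) : {mpoly K[n.+1]}) = ('X_i)%:P.
Proof.
rewrite muniE msuppX big_seq1 mcoeffX eqxx scale1r mnm1E widen_max expr0.
rewrite -[RHS]alg_polyC; congr (_ *: _); congr 'X_[_].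
by apply/mnmP => j; rewrite mnmE !mnm1E -!val_eqE.
Qed.

Lemma muni_Xmax : muni ('X_ord_max : {mpoly K[n.+1]}) = 'X.
Proof.
rewrite muniE msuppX big_seq1 mcoeffX eqxx scale1r mnm1E eqxx expr1.
rewrite -[RHS]scale1r -mpolyX0; congr (_ *: _); congr 'X_[_].
by apply/mnmP => j; rewrite mnmE mnm1E mnm0E eq_sym widen_max.
Qed.

(** [muni] singles out the last variable; its inverse substitutes that variable in
    the polynomial with widened coefficients. *)
Lemma muniK p : (map_poly (@mwiden n K) (muni p)).['X_ord_max] = p.
Proof.
apply: (@eq_rmorph_mpoly _ _ _
  (horner_eval 'X_ord_max \o map_poly (@mwiden n K) \o @muni n K) idfun) => [c|i] /=.
  by rewrite muniC map_polyC /= mwidenC /horner_eval hornerC.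
have [j ->|->] := unliftP ord_max i; last first.
  by rewrite muni_Xmax map_polyX /horner_eval hornerX.
have -> : lift ord_max j = widen j by apply/val_inj; rewrite /= /bump leqNgt ltn_ord.
by rewrite muni_Xwiden map_polyC /= mwiden_X /horner_eval hornerC.
Qed.

Lemma muni_spread (q : {poly {mpoly K[n]}}) :
  muni (map_poly (@mwiden n K) q).['X_ord_max] = q.
Proof.
rewrite -horner_map /= muni_Xmax -map_poly_comp.
have mw : @muni n K \o @mwiden n K =1 polyC.
  apply: (@eq_rmorph_mpoly _ _ _ (@muni n K \o @mwiden n K) polyC) => [c|i] /=.
    by rewrite mwidenC muniC.
  by rewrite mwiden_X muni_Xwiden.
rewrite (eq_map_poly mw); exact: comp_polyXr.
Qed.
End LastVariable.

Section AlgIndep.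

Variables (K L : fieldType) (iota : {rmorphism K -> L}).

Definition mev n (t : 'I_n -> L) : {mpoly K[n]} -> L :=
  meval t \o map_mpoly iota.
HB.instance Definition _ n (t : 'I_n -> L) := GRing.RMorphism.on (mev t).

Lemma mevC n (t : 'I_n -> L) c : mev t c%:MP = iota c.
Proof. by rewrite /mev /= map_mpolyC mevalC. Qed.

Lemma mevX n (t : 'I_n -> L) i : mev t 'X_i = t i.
Proof. by rewrite /mev /= map_mpolyX mevalXU. Qed.

Lemma ring_gen_mev n (t : 'I_n -> L) x :
  ring_gen iota (fun y => y \in codom t) x <-> exists p, mev t p = x.
Proof.
split=> [|[p <-]].
  elim=> {x} [c|_ /codomP [i ->]|_ _ _ [p <-] _ [q <-]|_ _ _ [p <-] _ [q <-]].
  - by exists c%:MP; rewrite mevC.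
  - by exists 'X_i; rewrite mevX.
  - by exists (p + q); rewrite rmorphD.
  - by exists (p * q); rewrite rmorphM.
rewrite rmorph_mpolyE; apply: (big_ind (ring_gen _ _)) => [|a b|m _].
- exact: ring_gen0.
- exact: ring_genD.
rewrite /= mevC; apply: ring_genM; first exact: ring_gen_base.
apply: (big_ind (ring_gen _ _)) => [|a b|i _]; [exact: ring_gen1|exact: ring_genM|].
rewrite mevX; elim: (m i) => [|k IHk]; first exact: ring_gen1.
by rewrite exprS; apply: ring_genM => //; apply: ring_gen_gen; apply: codom_f.
Qed.

Lemma mev_last n (t : 'I_n.+1 -> L) (q : {poly {mpoly K[n]}}) :
  mev t (map_poly (@mwiden n K) q).['X_ord_max] =
  (map_poly (mev (t \o widen_ord (leqnSn n))) q).[t ord_max].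
Proof.
rewrite -horner_map /= mevX -map_poly_comp; congr horner; apply: eq_map_poly.
apply: (@eq_rmorph_mpoly _ _ _ (mev t \o @mwiden n K)
                               (mev (t \o widen_ord (leqnSn n)))) => [c|i] /=.
  by rewrite mwidenC !mevC.
by rewrite mwiden_X !mevX.
Qed.

(** Algebraic independence adds one variable at a time, so that it can be compared
    with independence of lists. *)
Lemma alg_indep_rec n (t : 'I_n.+1 -> L) (t' := t \o widen_ord (leqnSn n)) :
  alg_indep iota t <-> alg_indep iota t' /\ ~ acl iota (codom t') (t ord_max).
Proof.
split=> [it|[it' nt] p p0].
  have it_poly (q : {poly {mpoly K[n]}}) : root (map_poly (mev t') q) (t ord_max) -> q = 0.
    move=> /rootP; rewrite -mev_last => /it q0.
    by rewrite -[q]muni_spread q0 raddf0.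
  split=> [p p0|/algebraic_ring_gen [q [q0 sq qt]]].
    apply/polyC_inj/it_poly; rewrite map_polyC /= /mev /= p0.
    by rewrite root0.
  have [//|i|r _ rq] := @lift_poly _ _ (mev t') (fun=> True) q.
    by have /ring_gen_mev [a <-] := sq i; exists a.
  by move: q0; rewrite -rq (it_poly r) ?rmorph0 ?eqxx ?rq.
rewrite -[p]muniK; set q := muni p.
have qt : root (map_poly (mev t') q) (t ord_max).
  by apply/rootP; rewrite -mev_last muniK.
have [->|q0] := eqVneq q 0; first by rewrite map_poly0 horner0.
case: nt; apply/algebraic_ring_gen; exists (map_poly (mev t') q); split=> //.
  rewrite map_poly_eq0_id0 ?q0 //; apply: contraNneq q0 => /it' /eqP.
  by rewrite lead_coef_eq0.
by move=> i; rewrite coef_map; apply/ring_gen_mev; exists q`_i.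
Qed.

Lemma alg_indep_ind n (t : 'I_n -> L) : alg_indep iota t <-> independent (acl iota) (codom t).
Proof.
elim: n t => [|n IHn] t.
  have -> : codom t = [::] by apply: size0nil; rewrite size_codom card_ord.
  split=> // _ p; rewrite (nvar0_mpolyC p) map_mpolyC mevalC => /eqP.
  by rewrite fmorph_eq0 => /eqP ->.
have -> : codom t = rcons (codom (t \o widen_ord (leqnSn n))) (t ord_max).
  by rewrite /codom /image_mem enum_ordSr map_rcons -map_comp.
rewrite alg_indep_rec IHn -cats1; split.
  by move=> [it nt]; apply/(ind_front (acl_pregeometry iota)); rewrite cats0.
by move/(ind_front (acl_pregeometry iota)); rewrite cats0 => -[nt it].
Qed.

Lemma is_trdeg_basis A n : is_trdeg iota (adjoin iota A) n ->
  exists u, [/\ size u = n, independent (acl iota) u,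
    forall x, x \in u -> algebraic_elt (adjoin iota A) x &
    forall x, A x -> acl iota u x].
Proof.
case=> t [tA it tspan]; exists (codom t).
rewrite size_codom card_ord; split=> // [|x /codomP [i ->]|x Ax].
- exact/alg_indep_ind.
- exact/algebraic_adjoin.
apply: algebraic_trans (tspan _ (adjoin_gen _ Ax)) => _ [i ->].
exact/algebraic_adjoin/adjoin_gen/codom_f.
Qed.

Lemma basis_is_trdeg A (u : seq L) : independent (acl iota) u ->
  (forall x, x \in u -> A x) -> (forall x, A x -> acl iota u x) ->
  is_trdeg iota (adjoin iota A) (size u).
Proof.
move=> iu uA Au; pose t (i : 'I_(size u)) := u`_i.
have codom_t : codom t = u.
  by rewrite -[RHS](mkseq_nth 0) /mkseq -val_enum_ord -map_comp.
exists t; split=> [i||x Ax].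
- by apply/adjoin_gen/uA/mem_nth.
- by apply/alg_indep_ind; rewrite codom_t.
apply: (@algebraic_trans _ _ _ (fun y => y \in u)).
  move=> y yu; apply/algebraic_adjoin/adjoin_gen.
  have : y \in codom t by rewrite codom_t.
  by case/codomP => i ->; exists i.
exact: algebraic_adjoin_closed Au Ax.
Qed.

End AlgIndep.

(** A transcendence basis of K(a_e : e in S) found among the a_e has the size of any
    other one by Steinitz, so the rank condition on all sets [S] is equivalent to
    the equality of independent sets. *)
Lemma algebraic_matroidP (K : fieldType) (E : finType) (M : matroid E) :
  algebraic_matroid K M <->
  exists (L : fieldType) (iota : {rmorphism K -> L}) (a : E -> L),
    represents (acl iota) a M.
Proof.
have rkS N (S : {set E}) : exists I, [/\ indep N I, I \subset S, rk N S = #|I| &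
    forall X, indep N X -> X \subset S -> #|X| <= #|I|]%N.
  have [I [_ IS iI max_I]] := indep_extend (indep0 N) (sub0set S).
  exists I; split=> //; apply/eqP; rewrite eqn_leq; apply/andP; split.
    by apply/bigmax_leqP => X /andP [iX XS]; apply: max_I.
  by rewrite /rk; apply: (bigmax_sup I); rewrite ?iI.
split=> -[L [iota [a aP]]]; exists L, iota, a => S; have clP := acl_pregeometry iota.
  have [u [su iu uS Su]] := is_trdeg_basis (aP S).
  have uS' x : x \in u -> acl iota (img a S) x.
    move/uS; apply: algebraic_trans => _ [e eS ->].
    by apply/algebraic_adjoin/adjoin_gen/mem_img.
  have Su' x : x \in img a S -> acl iota u x.
    by case/imgP => e eS ->; apply: Su; exists e.
  have [I [iI IS rI max_I]] := rkS M S.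
  split=> [iS|iS].
    apply: (ind_of_size clP iu uS'); rewrite size_img su rI.
    exact: max_I.
  have := steinitz clP iS Su'; rewrite size_img su rI => le_SI.
  by have /eqP <- : I == S by rewrite eqEcard IS.
have [I [iI IS rI max_I]] := rkS M S.
rewrite rI -(size_img a); apply: basis_is_trdeg; first exact/aP.
  by move=> _ /imgP [e eI ->]; exists e; rewrite ?(subsetP IS).
move=> _ [e eS ->]; apply: (indset_max clP) eS; [exact/aP|exact: IS|].
by move=> X /aP; apply: max_I.
Qed.

(** * Specializations of finitely generated rings *)

Definition horner_at (A : idomainType) (L : fieldType) (f : {rmorphism A -> L})
  (x : L) : {poly A} -> L := horner_eval x \o map_poly f.
HB.instance Definition _ (A : idomainType) (L : fieldType)
  (f : {rmorphism A -> L}) (x : L) := GRing.RMorphism.on (horner_at f x).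

Lemma horner_atE (A : idomainType) (L : fieldType) (f : {rmorphism A -> L}) x p :
  horner_at f x p = (map_poly f p).[x].
Proof. by []. Qed.

Lemma horner_atX (A : idomainType) (L : fieldType) (f : {rmorphism A -> L}) x :
  horner_at f x 'X = x.
Proof. by rewrite horner_atE map_polyX hornerX. Qed.

Lemma horner_atC (A : idomainType) (L : fieldType) (f : {rmorphism A -> L}) x a :
  horner_at f x a%:P = f a.
Proof. by rewrite horner_atE map_polyC hornerC. Qed.

Section Specialization.

Variables (K L F : fieldType).
Variables (iota : {rmorphism K -> L}) (kF : {rmorphism K -> F}).

(** The ring [A] stands for a finitely generated subring of [L] (its image under
    [f]), but need not embed in [L]. It is specializable when it maps to extensions
    O of [F] so that all relations that hold in [L] are preserved and any chosen
    nonzero element [D] stays nonzero. The list [w] consists of parameters that have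
    to become algebraic over [F], and [u] of elements that have to become
    independent over [F]. *)
Definition specializable (A : idomainType) (k : K -> A)
    (f : {rmorphism A -> L}) (w u : seq A) : Prop :=
  (forall c, f (k c) = iota c) /\
  forall D, f D != 0 ->
  exists (O : fieldType) (iF : {rmorphism F -> O}) (g : {rmorphism A -> O}),
    [/\ forall c, g (k c) = iF (kF c), forall a, a \in w -> acl iF [::] (g a),
        forall a, f a = 0 -> g a = 0, g D != 0 & independent (acl iF) (map g u)].

Definition im (A : idomainType) (f : {rmorphism A -> L}) (y : L) : Prop :=
  exists a, y = f a.

Definition alg_over (A : idomainType) (f : {rmorphism A -> L}) (x : L) : Prop :=
  exists p : {poly A}, map_poly f p != 0 /\ root (map_poly f p) x.

Lemma alg_overP (A : idomainType) (k : K -> A) (f : {rmorphism A -> L}) x :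
  (forall c, f (k c) = iota c) ->
  alg_over f x <-> algebraic_elt (adjoin iota (im f)) x.
Proof.
move=> fk; split=> [[p [p0 px]]|/algebraic_ring_gen [q [q0 fq qx]]].
  apply/algebraic_ring_gen; exists (map_poly f p); split=> // i.
  by apply: ring_gen_gen; exists p`_i; rewrite coef_map.
have im_ring z : ring_gen iota (im f) z -> im f z.
  elim=> {z} [c|//|y z _ [a ->] _ [b ->]|y z _ [a ->] _ [b ->]].
  - by exists (k c).
  - by exists (a + b); rewrite rmorphD.
  - by exists (a * b); rewrite rmorphM.
have [//|i|p _ eq_p] := @lift_poly _ _ f (fun=> True) q.
  by have [a ->] := im_ring _ (fq i); exists a.
by exists p; rewrite eq_p.
Qed.

(** Every element of the closure of a list of constants is algebraic over O, whereas
    X is transcendental over O. *)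
Lemma transcendental_fracX (O : fieldType) (iF : {rmorphism F -> O})
    (j : {rmorphism O -> {fraction {poly O}}})
    (iF' : {rmorphism F -> {fraction {poly O}}}) s :
  (forall c, j (iF c) = iF' c) -> (forall c, j c = tofrac c%:P) ->
  ~ acl iF' (map j s) (tofrac 'X).
Proof.
move=> jE jC aX.
have : acl j [::] (tofrac 'X).
  have sj y : y \in map j s -> acl j [::] y.
    by case/mapP => c _ ->; apply/algebraic_adjoin/adjoin_base.
  exact: acl_trans sj (acl_scalars jE aX).
case/algebraic_ring_gen => p [p0 jp px].
have [//|i|q _ eq_p] := @lift_poly _ _ j (fun=> True) p.
  elim: (jp i) => [c|//|y z _ [a [_ <-]] _ [b [_ <-]]|y z _ [a [_ <-]] _ [b [_ <-]]].
  - by exists c.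
  - by exists (a + b); rewrite rmorphD.
  - by exists (a * b); rewrite rmorphM.
have jq : map_poly j q = map_poly (@tofrac {poly O}) q^:P.
  by apply/polyP => i; rewrite !coef_map /= jC.
move: p0; rewrite -eq_p map_poly_eq0; move: px; rewrite -eq_p jq => /rootP.
rewrite horner_map /= => /eqP; rewrite tofrac_eq0.
by rewrite -[q^:P.['X]]/(q \Po 'X) comp_polyXr => ->.
Qed.

(** The new element goes to the variable of O(X). If a polynomial does not vanish at
    the new element, then one of its coefficients is nonzero in [L], and it suffices
    to keep that coefficient nonzero. *)
Lemma specializable_transcendental (A : idomainType) (k : K -> A)
    (f : {rmorphism A -> L}) (w u : seq A) x :
  ~ alg_over f x -> specializable k f w u ->
  specializable (polyC \o k) (horner_at f x) (map polyC w) ('X :: map polyC u).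
Proof.
move=> nx [fk fP]; split=> [c|D D0]; first by rewrite /= horner_atC.
have f0 p : horner_at f x p = 0 -> map_poly f p = 0.
  move=> fp0; apply/eqP; apply: contra_notT nx => p0.
  by exists p; split=> //; apply/rootP.
have mD0 : map_poly f D != 0.
  by apply: contraNneq D0 => mD0; rewrite /= horner_atE mD0 horner0.
have [i Di] : exists i, f D`_i != 0.
  exists (size (map_poly f D)).-1.
  by move: mD0; rewrite -lead_coef_eq0 /lead_coef coef_map.
have [O [iF [g [gk gw fg gD ug]]]] := fP _ Di.
pose j : {rmorphism O -> {fraction {poly O}}} := @tofrac {poly O} \o polyC.
pose iF' : {rmorphism F -> {fraction {poly O}}} := j \o iF.
pose g' : {rmorphism {poly A} -> {fraction {poly O}}} := @tofrac {poly O} \o map_poly g.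
exists {fraction {poly O}}, iF', g'.
have g'C a : g' a%:P = j (g a) by rewrite /g' /= map_polyC.
have mapg' s : map g' (map polyC s) = map j (map g s).
  by rewrite -!map_comp; apply: eq_map => a; rewrite [LHS]g'C.
split=> [c|_ /mapP [a aw ->]|p /f0 fp0||].
- by rewrite [LHS]g'C gk.
- by rewrite g'C; apply/(@acl_map _ _ _ iF iF' j (fun c => erefl) [::])/gw.
- rewrite /g' /=; have -> : map_poly g p = 0; last exact: tofrac0.
  apply/polyP => n; rewrite coef_map coef0 /=; apply: fg.
  by rewrite -coef_map fp0 coef0.
- rewrite /g' /= tofrac_eq0; apply: contraNneq gD => gD0.
  by rewrite -coef_map gD0 coef0.
rewrite map_cons mapg' /=; split; last exact/(@ind_acl_map _ _ _ iF iF' j (fun c => erefl)).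
rewrite /g' /= map_polyX; exact: transcendental_fracX.
Qed.

(** Over the ring [A] an annihilator of least degree divides any other one only after
    multiplication by a power of its leading coefficient, and up to a remainder
    that vanishes in [L]: pseudo-division. *)
Lemma min_annihilator (A : idomainType) (f : {rmorphism A -> L}) x :
  alg_over f x -> exists p : {poly A},
    [/\ f (lead_coef p) != 0, horner_at f x p = 0, (1 < size p)%N &
      forall q, horner_at f x q = 0 ->
        exists n s r, lead_coef p ^+ n *: q = s * p + r /\ map_poly f r = 0].
Proof.
pose P n := `[< exists p : {poly A},
  [/\ size p = n, f (lead_coef p) != 0 & horner_at f x p = 0] >].
(* Dropping the coefficients that vanish in L makes the leading one nonzero there. *)
have trunc p : map_poly f p != 0 -> horner_at f x p = 0 -> P (size (map_poly f p)).
  move=> fp0 px; apply/asboolP; set n := size _.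
  have n0 : (0 < n)%N by rewrite size_poly_gt0.
  have lc : f p`_n.-1 != 0 by move: fp0; rewrite -lead_coef_eq0 /lead_coef coef_map.
  have lc0 : p`_n.-1 != 0 by apply: contraNneq lc => ->; rewrite rmorph0.
  exists (\poly_(i < n) p`_i); rewrite size_poly_eq // lead_coef_poly //.
  split=> //; rewrite horner_atE -[RHS]px horner_atE; congr horner.
  apply/polyP => i; rewrite !coef_map coef_poly /=; case: ltnP => // le_ni.
  by rewrite raddf0 -coef_map nth_default.
move=> [p [p0 /rootP px]].
have [|n /asboolP [q [sq lq qx]] min_n] := @ex_minnP P; first by eexists; apply: trunc px.
exists q; split=> // [|r rx].
  rewrite sq ltnNge; apply: contra lq => n1; apply/eqP.
  have := size1_polyC (_ : size q <= 1)%N; rewrite sq => /(_ n1) qC.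
  by move: qx; rewrite qC horner_atC lead_coefC.
exists (Pdiv.IdomainDefs.scalp r q), (r %/ q), (r %% q).
split; first exact: Pdiv.Idomain.divp_eq.
apply/eqP; apply: contraT => fr0.
have q0 : q != 0 by apply: contraNneq lq => ->; rewrite lead_coef0 rmorph0.
have /min_n : P (size (map_poly f (r %% q))).
  apply: trunc => //.
  have := congr1 (horner_at f x) (Pdiv.Idomain.divp_eq r q).
  rewrite -mul_polyC rmorphM rmorphD rmorphM /= qx rx !mulr0 add0r => <-; exact: erefl.
rewrite leqNgt (leq_ltn_trans (size_poly _ _)) //.
by rewrite -sq ltn_modp.
Qed.

(** A nonzero algebraic element divides a nonzero constant: the constant term of its
    annihilator of least degree. Hence it stays nonzero when that constant does. *)
Lemma avoid_zero (A : idomainType) (k : K -> A) (f : {rmorphism A -> L}) x D :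
  (forall c, f (k c) = iota c) -> alg_over f x -> horner_at f x D != 0 ->
  exists d U V, [/\ f d != 0, d%:P = U * D + V & horner_at f x V = 0].
Proof.
move=> fk ax D0; set y := horner_at f x D in D0.
have : alg_over f y.
  apply/(alg_overP _ fk); apply: (@algebraic_adjoin_closed _ _ _ (fun z => im f z \/ z = x)).
    move=> z [fz|->]; last exact/(alg_overP _ fk).
    exact/algebraic_adjoin/adjoin_gen.
  apply: ring_gen_adjoin; apply: ring_gen_horner => [i|]; last first.
    by apply: ring_gen_gen; right.
  by rewrite coef_map; apply: ring_gen_gen; left; exists D`_i.
pose P n := `[< exists p : {poly A},
  [/\ size p = n, map_poly f p != 0 & root (map_poly f p) y] >].
move=> [p [p0 py]]; have [|n /asboolP [q [sq q0 qy]] min_n] := @ex_minnP P.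
  by exists (size p); apply/asboolP; exists p.
have [r [c qE]] : exists r c, q = r * 'X + c%:P.
  by elim/poly_ind: (q) => [|r c _]; [exists 0, 0; rewrite mul0r addr0|exists r, c].
have fqE : map_poly f q = map_poly f r * 'X + (f c)%:P.
  by rewrite qE rmorphD rmorphM /= map_polyX map_polyC.
have fc : f c != 0.
  apply: contraNneq D0 => c0; move: fqE; rewrite c0 addr0 => fqE.
  have r0 : map_poly f r != 0 by apply: contraNneq q0 => r0; rewrite fqE r0 mul0r.
  move: qy; rewrite fqE rootM rootX => /orP [ry|//].
  have : P (size r) by apply/asboolP; exists r.
  have rN0 : r != 0 by apply: contraNneq r0 => ->; rewrite rmorph0.
  by move/min_n; rewrite -sq qE size_MXaddC (negPf rN0) /= ltnn.
(* q(D) = r(D) D + c, and q(D) evaluates to q(y) = 0. *)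
exists c, (- (r \Po D)), (q \Po D); split=> //.
  by rewrite qE comp_polyD comp_polyM comp_polyX comp_polyC mulNr addrA addNr add0r.
by rewrite horner_atE map_comp_poly horner_comp -horner_atE; apply/rootP.
Qed.

(** The new element goes to a root of the specialized annihilator of least degree.
    Its leading coefficient being kept nonzero, the specialized annihilator is not
    constant, and pseudo-division shows that every relation goes to a relation. *)
Lemma specializable_algebraic (A : idomainType) (k : K -> A)
    (f : {rmorphism A -> L}) (w u : seq A) x :
  alg_over f x -> specializable k f w u ->
  specializable (polyC \o k) (horner_at f x) (map polyC w) (map polyC u).
Proof.
move=> ax [fk fP]; split=> [c|D D0]; first by rewrite /= horner_atC.
have [p [lp px p1 annP]] := min_annihilator ax.
have [d [U [V [fd dE Vx]]]] := avoid_zero fk ax D0.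
have [|O [iF [g [gk gw fg glpd ug]]]] := fP (lead_coef p * d).
  by rewrite rmorphM mulf_neq0.
move: glpd; rewrite rmorphM mulf_eq0 negb_or => /andP [glp gd].
have gp : (1 < size (map_poly g p))%N by rewrite size_map_poly_id0.
have [O' [j [y jy]]] := root_extension gp.
pose gj : {rmorphism A -> O'} := j \o g.
pose iF' : {rmorphism F -> O'} := j \o iF.
have py : horner_at gj y p = 0.
  by rewrite horner_atE map_poly_comp; apply/rootP.
have mapg' s : map (horner_at gj y) (map polyC s) = map j (map g s).
  by rewrite -!map_comp; apply: eq_map => a; rewrite /= horner_atC.
have ker q : horner_at f x q = 0 -> horner_at gj y q = 0.
  move=> /annP [n [s [r [qE fr]]]].
  have gr : horner_at gj y r = 0.
    rewrite horner_atE; have -> : map_poly gj r = 0; last exact: horner0.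
    apply/polyP => i; rewrite coef_map coef0 /= fg ?rmorph0 //.
    by rewrite -coef_map fr coef0.
  have /eqP := congr1 (horner_at gj y) qE.
  rewrite -mul_polyC rmorphM rmorphD rmorphM /= py gr mulr0 addr0 horner_atC.
  by rewrite mulf_eq0 /= !fmorph_eq0 rmorphXn expf_eq0 (negPf glp) andbF => /eqP.
exists O', iF', (horner_at gj y); split=> [c|_ /mapP [a aw ->]|//||].
- by rewrite /= horner_atC /= gk.
- by rewrite /= horner_atC /=; apply/(@acl_map _ _ _ iF iF' j (fun c => erefl) [::])/gw.
- have : horner_at gj y d%:P != 0 by rewrite horner_atC /= fmorph_eq0.
  by apply: contraNneq => D1; rewrite dE rmorphD rmorphM /= D1 mulr0 add0r ker.
by rewrite mapg'; apply/(@ind_acl_map _ _ _ iF iF' j (fun c => erefl)).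
Qed.

End Specialization.

(** * Contractions and direct sums of algebraic matroids *)

Section Specialize.

Variables (K L F : fieldType).
Variables (iota : {rmorphism K -> L}) (kF : {rmorphism K -> F}).

Let accP := acl_pregeometry iota.

Lemma im_map (A : idomainType) (f : {rmorphism A -> L}) s y : y \in map f s -> im f y.
Proof. by case/mapP => a _ ->; exists a. Qed.

Lemma specialize_basis (T : seq L) (A : idomainType) (k : K -> A)
    (f : {rmorphism A -> L}) (w : seq A) (s : seq L) :
  specializable iota kF k f w [::] -> map f w = T ->
  (forall a, acl iota T (f a)) -> independent (contraction (acl iota) T) s ->
  exists (A' : idomainType) (k' : K -> A') (f' : {rmorphism A' -> L})
         (w' u' : seq A'),
    [/\ specializable iota kF k' f' w' u', map f' w' = T, map f' u' = s &
        forall a, acl iota (T ++ s) (f' a)].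
Proof.
move=> sA fw fT; elim: s => [_|x s IHs [/= nx /IHs]].
  by exists A, k, f, w, [::]; split=> // a; rewrite cats0.
move=> [A' [k' [f' [w' [u' [sA' fw' fu' f'T]]]]]].
exists {poly A'}, (polyC \o k'), (horner_at f' x), (map polyC w'), ('X :: map polyC u').
have map_fC l : map (horner_at f' x) (map polyC l) = map f' l.
  by rewrite -map_comp; apply: eq_map => a; rewrite /= horner_atC.
split; rewrite ?map_cons ?map_fC ?fw' ?fu' /= ?horner_atX //.
  apply: specializable_transcendental => //.
  move/(alg_overP _ sA'.1) => ax; apply: nx.
  by apply: algebraic_trans ax => _ [a ->]; apply: f'T.
move=> p; apply: acl_ring; apply: ring_gen_horner => [i|].
  rewrite coef_map; apply: ring_gen_gen; apply: (cl_sub accP) (f'T p`_i) => z.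
  by rewrite !mem_cat inE => /orP [->|->]; rewrite ?orbT.
by apply/ring_gen_gen/(cl_mem accP); rewrite mem_cat mem_head orbT.
Qed.

Lemma specialize_algebraic (A : idomainType) (k : K -> A)
    (f : {rmorphism A -> L}) (w u : seq A) (l : seq L) :
  specializable iota kF k f w u ->
  (forall x, x \in l -> acl iota (map f w ++ map f u) x) ->
  exists (A' : idomainType) (k' : K -> A') (f' : {rmorphism A' -> L})
         (w' u' : seq A'),
    [/\ specializable iota kF k' f' w' u', map f' w' = map f w,
        map f' u' = map f u & forall x, x \in l -> im f' x].
Proof.
move=> sA; elim: l => [_|x l IHl lP]; first by exists A, k, f, w, u; split.
have [y yl|A' [k' [f' [w' [u' [sA' fw' fu' f'l]]]]]] := IHl.
  by apply: lP; rewrite inE yl orbT.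
exists {poly A'}, (polyC \o k'), (horner_at f' x), (map polyC w'), (map polyC u').
have map_fC s : map (horner_at f' x) (map polyC s) = map f' s.
  by rewrite -map_comp; apply: eq_map => a; rewrite /= horner_atC.
split; rewrite ?map_fC //.
  apply: specializable_algebraic => //; apply/(alg_overP _ sA'.1).
  apply: algebraic_trans (lP x (mem_head _ _)) => y.
  rewrite -fw' -fu' -map_cat => /im_map fy.
  exact/algebraic_adjoin/adjoin_gen.
move=> y; rewrite inE => /predU1P [->|/f'l [a ->]].
  by exists 'X; rewrite /= horner_atX.
by exists a%:P; rewrite /= horner_atC.
Qed.

(** Dependencies of the [a g] over [T] become dependencies of the [a' g], because
    each of the finitely many relations that witness them keeps a nonzero leading
    coefficient, its inverse being part of the ring. No further dependency appears,
    because a basis [B] was sent to an independent family ([weak_map_rank_eq]). *)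
Theorem specialization (G : finType) (a : G -> L) (T : seq L) (A : idomainType)
    (k : K -> A) (f : {rmorphism A -> L}) (w : seq A) :
  specializable iota kF k f w [::] -> map f w = T -> (forall c, acl iota T (f c)) ->
  exists (O : fieldType) (iF : {rmorphism F -> O}) (v : seq O) (a' : G -> O),
    [/\ size v = size T, forall z, z \in v -> acl iF [::] z,
        forall (S : {set G}) g, acl iota (T ++ img a S) (a g) ->
          acl (iF \o kF) (v ++ img a' S) (a' g) &
        forall (S : {set G}) g, acl iF (img a' S) (a' g) ->
          acl iota (T ++ img a S) (a g)].
Proof.
move=> sA fw fT; set cT := contraction (acl iota) T.
have cTP : pregeometry cT := contraction_pregeometry T accP.
have ind0 : indset cT a set0 by rewrite /indset /img enum_set0.
have [B [_ _ iB spanB]] := indset_extend cTP ind0 (sub0set setT).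
have [A1 [k1 [f1 [w1 [u1 [sA1 fw1 fu1 f1T]]]]]] := specialize_basis sA fw fT iB.
(* One relation for each dependency, and the zero polynomial elsewhere. *)
have /boolp.choice [pp ppP] : forall Sg : {set G} * G, exists p : {poly L},
    coefs_in (ring_gen iota (fun y => y \in T ++ img a Sg.1)) p /\
    (acl iota (T ++ img a Sg.1) (a Sg.2) -> p != 0 /\ root p (a Sg.2)).
  case=> S g /=; have [|ng] := EM (acl iota (T ++ img a S) (a g)); last first.
    by exists 0; split=> // i; rewrite coef0; apply: ring_gen0.
  by move/algebraic_ring_gen => [p [p0 sp px]]; exists p.
pose l := img a setT ++ [seq (lead_coef (pp Sg))^-1 | Sg : {set G} * G].
have [|A2 [k2 [f2 [w2 [u2 [sA2 fw2 fu2 f2l]]]]]] := @specialize_algebraic _ _ _ _ _ l sA1.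
  rewrite fw1 fu1 => x; rewrite mem_cat => /orP [/imgP [g _ ->]|]; first exact: spanB.
  case/codomP => -[S g] ->.
  apply: (@algebraic_adjoin_closed _ _ _ (acl iota (T ++ img a B))) => //.
  apply: adjoinV; apply: ring_gen_adjoin; apply: ring_gen_mono ((ppP (S, g)).1 _).
  move=> z /=; rewrite mem_cat => /orP [zT|/imgP [h _ ->]]; apply: ring_gen_gen.
    by apply/(cl_mem accP); rewrite mem_cat zT.
  exact: spanB.
rewrite {}fw1 in fw2; rewrite {}fu1 in fu2.
have [k2f spec] := sA2.
have [|O [iF [g2 [gk gw gker _ gu]]]] := spec 1; first by rewrite rmorph1 oner_neq0.
have gker2 b c : f2 b = f2 c -> g2 b = g2 c.
  move=> /eqP; rewrite -subr_eq0 -rmorphB => /eqP/gker/eqP.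
  by rewrite rmorphB subr_eq0 => /eqP.
have /boolp.choice [la laP] : forall g, exists b, f2 b = a g.
  by move=> g; have [|b ->] := f2l (a g); [rewrite mem_cat mem_img|exists b].
pose iK : {rmorphism K -> O} := iF \o kF.
exists O, iF, (map g2 w2), (g2 \o la).
have lift S z : ring_gen iota (fun y => y \in T ++ img a S) z ->
    exists b, ring_gen iK (fun y => y \in map g2 w2 ++ img (g2 \o la) S) (g2 b) /\ f2 b = z.
  elim=> {z} [c|z|y z _ [b [gb <-]] _ [c [gc <-]]|y z _ [b [gb <-]] _ [c [gc <-]]].
  - by exists (k2 c); rewrite gk k2f; split=> //; apply: ring_gen_base.
  - rewrite -fw2 mem_cat => /orP [/mapP [b bw ->]|/imgP [g gS ->]].
      by exists b; split=> //; apply: ring_gen_gen; rewrite mem_cat map_f.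
    exists (la g); rewrite laP; split=> //; apply: ring_gen_gen.
    by rewrite mem_cat -[g2 _]/((g2 \o la) g) mem_img ?orbT.
  - by exists (b + c); rewrite !rmorphD; split=> //; apply: ring_genD.
  - by exists (b * c); rewrite !rmorphM; split=> //; apply: ring_genM.
have up (S : {set G}) g : acl iota (T ++ img a S) (a g) ->
    acl iK (map g2 w2 ++ img (g2 \o la) S) (g2 (la g)).
  move=> ag; have [sp /(_ ag) [p0 pg]] := ppP (S, g).
  set p := pp (S, g) in sp p0 pg.
  have [|i|q gq fq] := @lift_poly _ _ f2
    (fun b => ring_gen iK (fun y => y \in map g2 w2 ++ img (g2 \o la) S) (g2 b)) p.
  - by rewrite rmorph0; apply: ring_gen0.
  - exact: lift (sp i).
  apply/algebraic_ring_gen; exists (map_poly g2 q); split.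
  - have [|b fb] := f2l (lead_coef p)^-1.
      by rewrite mem_cat; apply/orP; right; apply: (codom_f _ (S, g)).
    (* The leading coefficient is invertible in the ring, hence survives. *)
    have : g2 (q`_(size p).-1 * b - 1) = 0.
      apply: gker; rewrite rmorphB rmorphM rmorph1 -fb -coef_map fq.
      by rewrite -/(lead_coef p) divff ?subrr // lead_coef_eq0.
    apply: contra_eq_neq => q0.
    by rewrite rmorphB rmorphM rmorph1 -coef_map q0 coef0 mul0r sub0r oppr_eq0 oner_neq0.
  - by move=> i; rewrite coef_map; apply: gq.
  have /gker : f2 q.[la g] = 0 by rewrite -horner_map fq laP; apply/rootP.
  by rewrite -horner_map => /rootP.
split=> [|_ /mapP [b bw ->]|//|]; [by rewrite -fw2 !size_map|exact: gw|].
have upF (S : {set G}) g : cT (img a S) (a g) -> acl iF (img (g2 \o la) S) (g2 (la g)).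
  move=> /up /(@acl_scalars _ _ _ kF iF iK _ _ (fun c => erefl)).
  apply: (cl_trans (acl_pregeometry iF)) => y; rewrite mem_cat => /orP [/mapP [b bw ->]|yS].
    exact: (cl_sub (acl_pregeometry iF)) (gw b bw).
  exact: (cl_mem (acl_pregeometry iF)).
apply: (weak_map_rank_eq cTP (acl_pregeometry iF) upF iB) => [|g]; last exact: spanB.
have gmap s1 s2 : map f2 s1 = map f2 s2 -> map g2 s1 = map g2 s2.
  elim: s1 s2 => [|b s1 IHs] [|c s2] //= [fbc /IHs ->].
  by rewrite (gker2 _ _ fbc).
suff : map g2 u2 = img (g2 \o la) B by rewrite /indset => <-.
rewrite /img (map_comp g2 la); apply: gmap; rewrite fu2 -map_comp.
by apply: eq_map => g /=; rewrite laP.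
Qed.

End Specialize.

(** To send the transcendental parameter [t] to an element [y] algebraic over K with
    D(y) nonzero, take for [y] a root of X D(X) + 1. *)
Lemma specializable_parameter (K L : fieldType) (iota : {rmorphism K -> L}) t :
  ~ acl iota [::] t ->
  specializable iota idfun polyC (horner_at iota t) [:: 'X] [::].
Proof.
move=> nt; split=> [c|D D0]; first by rewrite /= horner_atC.
have inj p : horner_at iota t p = 0 -> p = 0.
  move=> pt; apply/eqP; apply: contra_notT nt => p0.
  exists (map_poly iota p); rewrite map_poly_eq0 p0; split=> //.
    by move=> i; rewrite coef_map; apply: adjoin_base.
  by apply/rootP.
have D0' : D != 0 by apply: contraNneq D0 => ->; rewrite rmorph0.
have [|O [j [y jy]]] := @root_extension _ (D * 'X + 1%:P).
  by rewrite size_MXaddC (negPf D0') ltnS size_poly_gt0.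
exists O, j, (horner_at j y); split=> [c|a|p /inj ->||//].
- by rewrite /= horner_atC.
- rewrite inE => /eqP -> /=; rewrite horner_atX.
  exists (map_poly j (D * 'X + 1%:P)); split=> //.
    rewrite map_poly_eq0 -size_poly_eq0 size_MXaddC (negPf D0').
    by [].
  by move=> i; rewrite coef_map; apply: adjoin_base.
- by rewrite rmorph0.
apply/negP => /eqP /= Dy; move/rootP: jy; rewrite -horner_atE rmorphD rmorphM /=.
by rewrite Dy mul0r add0r horner_atC rmorph1 => /eqP; rewrite oner_eq0.
Qed.

(** Contracting [t] means passing to the ground field K(t). When [t] is
    transcendental, a specialization of [t] to an algebraic element brings the
    ground field back to K. *)
Lemma contract_one (K L : fieldType) (iota : {rmorphism K -> L}) (G : finType)
    (a : G -> L) t :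
  exists (O : fieldType) (j : {rmorphism K -> O}) (a' : G -> O),
    forall (S : {set G}) g,
      acl iota (t :: img a S) (a g) <-> acl j (img a' S) (a' g).
Proof.
have accP (O : fieldType) (j : {rmorphism K -> O}) := acl_pregeometry j.
have [at0|nt] := EM (acl iota [::] t).
  exists L, iota, a => S g; split; last first.
    by apply: (cl_sub (accP _ _)) => z zS; rewrite inE zS orbT.
  apply: (cl_trans (accP _ _)) => z; rewrite inE => /predU1P [->|zS].
    exact: (cl_sub (accP _ _)) at0.
  exact: (cl_mem (accP _ _)).
have [|p|O [j [v [a' [_ vP up dn]]]]] :=
    specialization a (T := [:: t]) (specializable_parameter nt).
- by rewrite /= horner_atX.
- apply: acl_ring; rewrite /= horner_atE; apply: ring_gen_horner => [i|].
    by rewrite coef_map; apply: ring_gen_base.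
  by apply/ring_gen_gen/(cl_mem (accP _ _)); rewrite mem_head.
exists O, j, a' => S g; split=> [/up|/dn //].
move=> /(@acl_scalars _ _ _ idfun j (j \o idfun) _ _ (fun c => erefl)).
apply: (cl_trans (accP _ _)) => z; rewrite mem_cat => /orP [/vP|zS].
  exact: (cl_sub (accP _ _)).
exact: (cl_mem (accP _ _)).
Qed.

Lemma algebraic_contraction (K L : fieldType) (iota : {rmorphism K -> L})
    (G : finType) (a : G -> L) (l : seq G) :
  exists (O : fieldType) (j : {rmorphism K -> O}) (a' : G -> O),
    forall (S : {set G}) g,
      contraction (acl iota) (map a l) (img a S) (a g) <->
      acl j (img a' S) (a' g).
Proof.
have accP (O : fieldType) (j : {rmorphism K -> O}) := acl_pregeometry j.
elim: l => [|e l [O [j [a' aP]]]]; first by exists L, iota, a.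
have [O' [j' [b bP]]] := contract_one j a' (a' e).
exists O', j', b => S g; rewrite -bP.
have eS z : (z \in img a' (e |: S)) = (z \in a' e :: img a' S).
  rewrite inE; apply/imgP/predU1P => [[h]|[->|/imgP [h hS ->]]].
  - by rewrite !inE => /predU1P [->|hS] ->; [left|right; apply: mem_img].
  - by exists e; rewrite ?setU11.
  - by exists h; rewrite // inE hS orbT.
have -> : acl j (a' e :: img a' S) (a' g) <-> acl j (img a' (e |: S)) (a' g).
  by split; apply: (cl_sub (accP _ _)) => z; rewrite eS.
rewrite -aP; split; apply: (cl_sub (accP _ _)) => z; rewrite !(mem_cat, inE) /=.
  rewrite -orbA => /or3P [/eqP ->|->|/imgP [h hS ->]] //.
    by rewrite mem_img ?setU11 ?orbT.
  by rewrite mem_img ?orbT // inE hS orbT.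
case/orP => [->|/imgP [h]]; first by rewrite orbT.
rewrite !inE => /predU1P [->|hS] ->; first by rewrite eqxx.
by rewrite mem_img ?orbT.
Qed.

(** Two field extensions of K have to be put into a common one, free from each
    other. Specializing the second one with [F] the first extension does it: a
    basis of the second family becomes independent over the whole of the first
    field. *)
Lemma algebraic_dsum (K : fieldType) (E F : finType) (M : matroid E) (N : matroid F) :
  (exists (L : fieldType) (iota : {rmorphism K -> L}) a, represents (acl iota) a M) ->
  (exists (L : fieldType) (iota : {rmorphism K -> L}) a, represents (acl iota) a N) ->
  exists (L : fieldType) (iota : {rmorphism K -> L}) (a : E + F -> L),
    represents (acl iota) a (dsum M N).
Proof.
move=> [L1 [i1 [a aP]]] [L2 [i2 [b bP]]].
have accP (O J : fieldType) (j : {rmorphism J -> O}) := acl_pregeometry j.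
have base : specializable i2 i1 idfun i2 [::] [::].
  split=> // D D0; exists L1, idfun, i1; split=> // [c|].
    by rewrite -(rmorph0 i2) => /fmorph_inj ->; rewrite rmorph0.
  by rewrite fmorph_eq0; rewrite fmorph_eq0 in D0.
have [//|c|O [j [v [b' [/size0nil v0 _ up dn]]]]] :=
    specialization b (T := [::]) base.
  by apply/algebraic_adjoin/adjoin_base.
rewrite {}v0 in up; pose iK : {rmorphism K -> O} := j \o i1.
pose c g := match g with inl e => j (a e) | inr e => b' e end.
exists O, iK, c => S; have := perm_img_sum c S.
have -> : img (c \o inl) (inl @^-1: S) = map j (img a (inl @^-1: S)).
  by rewrite /img -map_comp; apply: eq_map.
rewrite -[c \o inr]/b' => pS.
have -> : indset (acl iK) c S <->
    independent (acl iK) (img b' (inr @^-1: S) ++ map j (img a (inl @^-1: S))).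
  split; first exact: (ind_perm (accP _ _ _)).
  by rewrite perm_sym in pS; apply: (ind_perm (accP _ _ _)).
have ind_cat s r : independent (acl j) s -> (forall y, y \in r -> exists x, y = j x) ->
    independent (acl iK) r -> independent (acl iK) (s ++ r).
  move=> + rj ir; elim: s => [//|x s IHs] /= [nx /IHs is_]; split=> //.
  move=> /(@acl_scalars _ _ _ i1 j iK _ _ (fun c => erefl)) cx; apply: nx.
  apply: (cl_trans (accP _ _ _)) cx => y; rewrite mem_cat => /orP [ys|/rj [z ->]].
    exact: (cl_mem (accP _ _ _)).
  exact/algebraic_adjoin/adjoin_base.
have ind_l s : independent (acl iK) (map j s) <-> independent (acl i1) s.
  exact: (@ind_acl_map _ _ _ i1 iK j (fun c => erefl)).
rewrite /= /dsum_indep; split=> [/andP [/aP iM /bP iN]|iS].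
  apply: ind_cat; last exact/ind_l.
    exact: (weak_map_indset (accP _ _ _) (accP _ _ _) dn).
  by move=> _ /mapP [x _ ->]; exists x.
apply/andP; split; first by apply/aP/ind_l; apply: ind_catr iS.
apply/bP; apply: (weak_map_indset (accP _ _ _) (accP _ _ _) up).
rewrite /indset; elim: (img b' _) iS => //= x s IHs [nx /IHs is_]; split=> // cx.
apply: nx; apply: (cl_sub (accP _ _ _)) cx => y.
by rewrite mem_cat => ->.
Qed.

(** * Correspondences of algebraic and of representable matroids *)

Lemma infinite_nat : infinite nat.
Proof.
move=> s; exists (\max_(n <- s) n).+1; apply/negP => /(@leq_bigmax_seq _ s xpredT id).
by rewrite ltnn => /(_ isT).
Qed.

Lemma mem_img_comp (E F : finType) (T : eqType) (f : E -> F) (a : F -> T)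
  (S : {set E}) : img a (f @: S) =i img (a \o f) S.
Proof.
move=> x; apply/imgP/imgP => [[_ /imsetP [e eS ->] ->]|[e eS ->]].
  by exists e.
by exists (f e); rewrite ?imset_f.
Qed.

Lemma algebraic_corr (K : fieldType) (E1 E2 : finType) (C : matroid (E1 + E2)%type)
    (M : matroid E1) :
  algebraic_matroid K C -> algebraic_matroid K M -> algebraic_matroid K (corr C M).
Proof.
move=> /algebraic_matroidP aC /algebraic_matroidP aM; apply/algebraic_matroidP.
have [L [iota [c cP]]] := algebraic_dsum aC aM.
have accP (O : fieldType) (j : {rmorphism K -> O}) := acl_pregeometry j.
have [a aP] := union_mix (accP _ _) (acl_mixing iota) infinite_nat cP.
have [O [j [b bP]]] := algebraic_contraction iota a [seq inl e | e <- enum setT].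
rewrite -map_comp in bP.
have repr := corr_represents (accP _ _) aP.
exists O, j, (b \o inr) => S; rewrite repr; apply: indset_ext => //; last first.
  exact/contraction_pregeometry.
move=> U e; have := bP (inr @: U) (inr e).
have -> : acl j (img b (inr @: U)) (b (inr e)) <-> acl j (img (b \o inr) U) (b (inr e)).
  by split; apply: (cl_sub (accP _ _)) => x; rewrite mem_img_comp.
move=> <-; rewrite /contraction.
by split; apply: (cl_sub (accP _ _)) => x; rewrite !mem_cat mem_img_comp.
Qed.

Lemma representable_corr (K : fieldType) (E1 E2 : finType)
    (C : matroid (E1 + E2)%type) (M : matroid E1) : infinite_field K ->
  representable_matroid K C -> representable_matroid K M ->
  representable_matroid K (corr C M).
Proof.
move=> infK rC rM; apply/representableP.
have [n [c cP]] := representable_dsum rC rM.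
have linP := lin_pregeometry 'rV[K]_n.
have [a aP] := union_mix linP (lin_mixing 'rV[K]_n) infK cP.
have [f fP] := lin_contraction (img (a \o inl) setT).
exists n, (f \o (a \o inr)) => S; rewrite (corr_represents linP aP).
apply: indset_ext => //; last exact/contraction_pregeometry.
by move=> U e; rewrite fP /img -map_comp.
Qed.

Theorem proposition2p5 (E1 E2 : finType) (C : matroid (E1 + E2)%type) :
  (forall K : fieldType, algebraic_matroid K C ->
     forall M : matroid E1, algebraic_matroid K M ->
       algebraic_matroid K (corr C M))
  /\
  (forall K : fieldType, infinite_field K -> representable_matroid K C ->
     forall M : matroid E1, representable_matroid K M ->
       representable_matroid K (corr C M)).
Proof.
split=> K; first by move=> aC M; apply: algebraic_corr.
by move=> infK rC M; apply: representable_corr.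
Qed.
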